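(* Let $d \ge 2$ and $r \ge 2$ be integers. Then $N_{\mathrm{hyp}}(t,d,r) = rt + O_{d,r}\left(t^{1/2-1/(2d)}\sqrt{\log(t+1)}\right)$ for positive integers $t$; that is, there exists a constant $C_{d,r} > 0$, depending only on $d$ and $r$, such that for every positive integer $t$, $$\left| N_{\mathrm{hyp}}(t,d,r) - rt \right| \;\le\; C_{d,r}\, t^{1/2-1/(2d)}\sqrt{\log(t+1)}.$$
   Context: For a finite set $X'$ of (affine) hyperplanes in $\mathbb{R}^d$, its regression hull $D(X') \subseteq \mathbb{R}^d$ is the set of points $p \in \mathbb{R}^d$ such that every closed ray starting from $p$ intersects or is parallel to at least one hyperplane in $X'$. (In particular $D(\emptyset)=\emptyset$.) For positive integers $t,d,r$, $N_{\mathrm{hyp}}(t,d,r)$ denotes the smallest positive integer $N$ such that every family $X$ of $N$ hyperplanes in $\mathbb{R}^d$ has a partition $X = X_1 \sqcup \cdots \sqcup X_r$ into $r$ parts such that $\bigcap_{j=1}^r D(X_j \setminus C) \neq \emptyset$ for every subset $C \subseteq X$ of at most $t$ hyperplanes. *)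

(* Defs.v *)
From HB Require Import structures.
From mathcomp Require Import all_boot all_order all_algebra.
From mathcomp Require Import all_classical all_reals all_analysis.

Set Implicit Arguments.
Unset Strict Implicit.
Unset Printing Implicit Defensive.

Import Order.TTheory GRing.Theory Num.Theory.

Local Open Scope classical_set_scope.
Local Open Scope card_scope.
Local Open Scope ring_scope.

Section RegressionHull.
Context {R : realType} {d : nat}.
Implicit Types (p v : 'rV[R]_d) (H : set 'rV[R]_d) (X : set (set 'rV[R]_d)).

Definition hyperplane H : Prop :=
  exists (a : 'rV[R]_d) (b : R),
    a != 0 /\ H = [set x | \sum_(i < d) a 0 i * x 0 i = b].

(* The linear subspace H - H parallel to the affine subspace H. *)
Definition direction H : set 'rV[R]_d :=
  [set v | exists x y, [/\ H x, H y & v = y - x]].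

Definition closed_ray p v : set 'rV[R]_d :=
  [set x | exists s : R, 0 <= s /\ x = p + s *: v].

Definition regression_hull X : set 'rV[R]_d :=
  [set p | forall v, v != 0 ->
     exists H, X H /\ (closed_ray p v `&` H !=set0 \/ direction H v)].

End RegressionHull.

(* A family of N hyperplanes is a set of N distinct hyperplanes.
   The parts of a partition are labelled by 'I_r and may a priori be empty
   (the condition on the hulls excludes it, as the hull of set0 is empty). *)
Definition tolerant_partition_size (R : realType) (t d r N : nat) : Prop :=
  forall X : set (set 'rV[R]_d),
    X `<=` hyperplane -> X #= `I_N ->
    exists P : 'I_r -> set (set 'rV[R]_d),
      [/\ \bigcup_j P j = X,
          trivIset setT P &
          forall C : set (set 'rV[R]_d), C `<=` X -> C #<= `I_t ->
            \bigcap_j regression_hull (P j `\` C) !=set0].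

(* is_Nhyp R t d r N says that N_hyp(t,d,r) exists and equals N. *)
Definition is_Nhyp (R : realType) (t d r N : nat) : Prop :=
  [/\ (0 < N)%N,
      tolerant_partition_size R t d r N &
      forall M : nat, (0 < M)%N -> tolerant_partition_size R t d r M ->
        (N <= M)%N].

(* Main.v *)
Require Import Defs.
From mathcomp Require Import all_boot all_order all_algebra.
From mathcomp Require Import all_classical all_reals all_analysis.
From mathcomp Require Import ring lra zify.

(** Write a hyperplane as a.x = b. The ray from p in direction v meets it or is
parallel to it exactly when (a.p - b)(a.v) <= 0. Let S(p, v) be the set of
members of the family X with this property; then p lies in the hull of Y as soon
as S(p, v) meets Y for every v.

At least rt hyperplanes are necessary: in a smaller family some part has at most
t members, and deleting that part leaves an empty hull (tolerant_size_ge).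

That rt + O(q(t)) hyperplanes suffice, where
q(t) = t^(1/2 - 1/(2d)) sqrt(log(t + 1)), rests on two facts.

- Topology (common_hull_or_escape). For sets Y_1, ..., Y_r of hyperplanes of X,
  either the hulls of the Y_j have a common point, or there are one point p and
  directions v_j, for j in some set J, such that S(p, v_j) misses Y_j and yet the
  sets S(p, v_j), j in J, cover X. If no point is common, every p has a label j
  and a direction w along which one moves away from every member of Y_j; these
  pairs depend only on the sign vector of p, so they glue to a continuous field of
  positive combinations of escape directions. Far away the field is replaced by
  an outward one which never moves towards a hyperplane, so by Brouwer it has a
  zero. There sum_j v_j = 0, up to a vector n with (a.p - b)(a.n) >= 0 for every
  hyperplane, and hence for no hyperplane can all the numbers (a.p - b)(a.v_j) be
  positive: this is the covering.

- Discrepancy (ray_discrepancy_rate). A family of rm hyperplanes has an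
  r-colouring such that, for every p, v and colour j, the set S = S(p, v) contains
  at least (|S| - D q(m)) / r hyperplanes of colour j, with D depending on d and r
  only. Projective duality turns the hyperplanes into points of a d-dimensional
  affine space and S(p, v) into a set determined by four open half-spaces.
  Haussler's packing lemma, in its sharp form without logarithm, finds r points
  that few half-spaces separate; with multiplicative reweighting this partitions
  the points into m groups of size r such that every half-space splits only
  O(m^(1 - 1/d)) of them (low_crossing_bound). Colouring every group bijectively,
  with a cyclic shift chosen by an exponential moment argument, only the split
  groups contribute to the error (balanced_colouring).

Now colour a family of rm hyperplanes in this way, delete a set C of at most t of
them, and suppose that the remaining parts have no common point. The sets
S_j = S(p, v_j) of the first fact satisfy rm <= sum_j |S_j|, and S_j meets the
part X_j only inside C, so that sum_j |S_j| <= r t + r D q(m). Thus m > t + D q(m)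
guarantees tolerance t, and m = t + O(q(t)) achieves this because q(m) = O(q(t))
with a power of the ratio m / t smaller than one (rate_growth). *)

Set Implicit Arguments.
Unset Strict Implicit.
Unset Printing Implicit Defensive.

Import Order.TTheory GRing.Theory Num.Theory.
Import numFieldNormedType.Exports.

Local Open Scope ring_scope.

(** * A mod 2 intersection number on the grid *)

Section Cochain.
Variables (d : nat) (K : comNzRingType).
Hypothesis addKK : forall x : K, x + x = 0.
Notation pt := ('I_d -> nat).
Implicit Types (x y : pt) (A : {set 'I_d}) (f g : pt -> K) (s : seq 'I_d).

Definition bump_coord (a : 'I_d) x : pt := fun i => (x i + (i == a))%N.
Definition set_coord x (a : 'I_d) (c : nat) : pt := fun i => if i == a then c else x i.
Definition incr f a x := f (bump_coord a x) + f x.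

(** The cup product of the coboundaries of the functions [fs], summed over all
lattice paths from [x] that take one step in a new direction of [A] for each
factor. In characteristic 2 no orientation signs are needed. *)
Fixpoint cup (fs : seq (pt -> K)) A x : K :=
  if fs is f :: fs' then
    \sum_(a in A) incr f a x * cup fs' (A :\ a) (bump_coord a x)
  else 1.

Lemma bump_coordC a b x : bump_coord a (bump_coord b x) = bump_coord b (bump_coord a x).
Proof. by apply: funext => i; rewrite /bump_coord addnAC. Qed.

Lemma sum_sym_char2 A (s : 'I_d -> 'I_d -> K) : (forall a b, s a b = s b a) ->
  \sum_(a in A) \sum_(b in A :\ a) s a b = 0.
Proof.
move=> ssym.
have split_sum a : \sum_(b in A :\ a) s a b =
    \sum_(b in A | (a < b)%N) s a b + \sum_(b in A | (b < a)%N) s a b.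
  rewrite (bigID (fun b : 'I_d => (a < b)%N)) /=; congr (_ + _).
    apply: eq_bigl => b; rewrite !inE; case: (ltnP a b) => ab; rewrite ?andbF//.
    by rewrite !andbT neq_ltn ab orbT.
  apply: eq_bigl => b; rewrite !inE -leqNgt ltn_neqAle.
  by rewrite -val_eqE andbCA andbA.
rewrite (eq_bigr _ (fun a _ => split_sum a)) big_split /=.
rewrite [X in X + _](exchange_big_dep (mem A)) /=; last by move=> a b _ /andP[].
rewrite -[RHS](addKK (\sum_(b in A) \sum_(a in A | (a < b)%N) s a b)); congr (_ + _).
  by apply: eq_bigr => b bA; apply: eq_bigl => a; rewrite bA.
by apply: eq_bigr => b bA; apply: eq_bigr => a _; rewrite ssym.
Qed.

(** A product of coboundaries is a cocycle. The terms with a second difference of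
the first factor are symmetric in the two directions involved and cancel in
pairs; the remaining terms are the same statement for the other factors. *)
Lemma cup_closed fs A x : \sum_(a in A) incr (cup fs (A :\ a)) a x = 0.
Proof.
elim: fs A x => [|f fs IH] A x /=.
  by rewrite big1// => a _; rewrite /incr addKK.
transitivity (\sum_(a in A) \sum_(b in A :\ a)
    ((incr f b (bump_coord a x) + incr f b x) *
      cup fs (A :\ a :\ b) (bump_coord b (bump_coord a x)))
  + \sum_(b in A) incr f b x *
      \sum_(a in A :\ b) incr (cup fs (A :\ b :\ a)) a (bump_coord b x)); last first.
  rewrite sum_sym_char2 ?add0r; last first.
    move=> a b; rewrite bump_coordC /incr !(bump_coordC a b).
    by rewrite !finset.setDDl (finset.setUC [set a]); ring.
  by rewrite big1// => b _; rewrite IH mulr0.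
under [X in _ = _ + X]eq_bigr do rewrite mulr_sumr.
rewrite [X in _ = _ + X](exchange_big_dep (mem A)) /=; last first.
  by move=> b a _; rewrite !inE => /andP[].
rewrite -big_split /=; apply: eq_bigr => a aA.
rewrite [X in _ = _ + X](eq_bigl (mem (A :\ a))); last first.
  by move=> b /=; rewrite !inE aA andbT eq_sym andbC.
rewrite /incr -!big_split /=; apply: eq_bigr => b _.
rewrite (bump_coordC a b) (_ : A :\ b :\ a = A :\ a :\ b); last first.
  by rewrite !finset.setDDl finset.setUC.
set u := f _; set v := f _; set w := f _; set z := f _.
set g := cup _ _ _; set h := cup _ _ _.
rewrite [RHS](_ : _ = (u + v) * g + (w + z) * h + ((w + z) * g + (w + z) * g)); last by ring.
by rewrite addKK addr0.
Qed.

(** The Leibniz rule; the second half of it vanishes by [cup_closed]. *)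
Lemma cup_exact f fs A x :
  cup (f :: fs) A x = \sum_(a in A) incr (fun y => f y * cup fs (A :\ a) y) a x.
Proof.
rewrite -[RHS]addr0 -[X in _ = _ + X](mulr0 (f x)) -[X in _ = _ + _ * X](cup_closed fs A x).
rewrite mulr_sumr -big_split /=.
apply: eq_bigr => a _; rewrite /incr.
set u := f _; set v := f _; set g := cup _ _ _; set h := cup _ _ _.
rewrite [RHS](_ : _ = (u + v) * g + (v * h + v * h)); last by ring.
by rewrite addKK addr0.
Qed.

Lemma cup_const fs A x a f v : f \in fs -> a \notin A ->
  (forall y, y a = x a -> f y = v) -> cup fs A x = 0.
Proof.
move=> + + fv; elim: fs A x fv => // g fs IH A x fv.
rewrite in_cons => /orP[/eqP <- aA|ffs aA] /=; apply: big1 => b bA.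
  have ab : (a == b) = false by apply/eqP => ab; rewrite ab bA in aA.
  by rewrite /incr !fv ?addKK ?mul0r// /bump_coord ab addn0.
have ab : (a == b) = false by apply/eqP => ab; rewrite ab bA in aA.
rewrite (IH (A :\ b)) ?mulr0 ?inE ?negb_and ?aA ?orbT// => y.
by rewrite /bump_coord ab addn0; apply: fv.
Qed.

Variable k : nat.

(** Only the coordinates listed in [s] are summed over; the others are read off from
[x], so that sums over faces of the cube are covered by the same definition. *)
Fixpoint boxsum s f x : K :=
  if s is a :: s' then \sum_(c < k) boxsum s' f (set_coord x a c) else f x.

Lemma eq_boxsum s f g x : f =1 g -> boxsum s f x = boxsum s g x.
Proof. by move=> fg; elim: s x => //= a s IH x; apply: eq_bigr => c _. Qed.

Lemma boxsum_sum (T : finType) (P : {pred T}) (F : T -> pt -> K) s x :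
  boxsum s (fun y => \sum_(t in P) F t y) x = \sum_(t in P) boxsum s (F t) x.
Proof.
elim: s x => //= a s IH x; under eq_bigr do rewrite IH.
by rewrite exchange_big.
Qed.

Lemma boxsumD s f g x :
  boxsum s (fun y => f y + g y) x = boxsum s f x + boxsum s g x.
Proof. by elim: s x => //= a s IH x; under eq_bigr do rewrite IH; rewrite big_split. Qed.

Lemma boxsum0 s f x : (forall y, f y = 0) -> boxsum s f x = 0.
Proof. by move=> f0; elim: s x => //= a s IH x; rewrite big1. Qed.

Lemma set_coordC x a b c e : a != b -> set_coord (set_coord x a c) b e = set_coord (set_coord x b e) a c.
Proof.
move=> ab; apply: funext => i; rewrite /set_coord.
by case: (eqVneq i b) => // ->; rewrite eq_sym (negbTE ab).
Qed.

Lemma boxsum_set s f x a c : a \notin s ->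
  boxsum s (fun y => f (set_coord y a c)) x = boxsum s f (set_coord x a c).
Proof.
elim: s x => //= b s IH x; rewrite in_cons negb_or => /andP[ab as_].
by apply: eq_bigr => e _; rewrite IH// set_coordC// eq_sym.
Qed.

Lemma boxsum_bump s f x a : a \notin s ->
  boxsum s (fun y => f (bump_coord a y)) x = boxsum s f (bump_coord a x).
Proof.
elim: s x => //= b s IH x; rewrite in_cons negb_or => /andP[ab as_].
apply: eq_bigr => e _; rewrite IH//; congr boxsum.
apply: funext => i; rewrite /bump_coord /set_coord.
by case: (eqVneq i b) => // ->; rewrite eq_sym (negbTE ab) addn0.
Qed.

(** Telescoping in the direction [a]. *)
Lemma boxsum_incr s f x a : uniq s -> a \in s ->
  boxsum s (incr f a) x =
  boxsum (rem a s) (fun y => f (set_coord y a k) + f (set_coord y a 0%N)) x.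
Proof.
elim: s x => //= b s IH x /andP[bs us]; rewrite in_cons; case: eqVneq => [->|ab] /=.
  move=> _; rewrite boxsumD !boxsum_set//.
  have tel n : \sum_(c < n) boxsum s (incr f b) (set_coord x b c)
    = boxsum s f (set_coord x b n) + boxsum s f (set_coord x b 0).
    elim: n => [|n IHn]; first by rewrite big_ord0 addKK.
    rewrite big_ord_recr /= IHn [boxsum s (incr _ _) _]boxsumD boxsum_bump//.
    have -> : bump_coord b (set_coord x b n) = set_coord x b n.+1.
      by apply: funext => i; rewrite /bump_coord /set_coord; case: eqVneq; rewrite ?addn1 ?addn0.
    have E (u v w : K) : u + v + (w + u) = w + v.
      have -> : u + v + (w + u) = w + v + (u + u) by ring.
      by rewrite addKK addr0.
    exact: E.
  by rewrite tel.
by move=> ains; apply: eq_bigr => c _; exact: IH.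
Qed.

Lemma boxsum_neq0 s f x : uniq s -> boxsum s f x != 0 ->
  exists y, [/\ forall i, i \in s -> (y i < k)%N,
     forall i, i \notin s -> y i = x i & f y != 0].
Proof.
elim: s x => [|a s IH] x /=; first by exists x.
move=> /andP[as_ us] nz.
have [c nzc] : exists c : 'I_k, boxsum s f (set_coord x a c) != 0.
  apply/existsP; apply: contra_neqT nz => /existsPn h; apply: big1 => c _.
  by have := h c; rewrite negbK => /eqP.
have [y [ys yn fy]] := IH _ us nzc; exists y; split=> // i; rewrite in_cons.
  by case: (eqVneq i a) => [->|_ /ys//] _; rewrite yn// /set_coord eqxx.
by rewrite negb_or => /andP[ia /yn ->]; rewrite /set_coord (negbTE ia).
Qed.

(** A nonzero product has a path on which each factor changes, hence a unit cube on
which each function takes two values. *)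
Lemma cup_neq0 fs A x f : cup fs A x != 0 -> f \in fs ->
  exists y a, [/\ f (bump_coord a y) != f y, forall i, (x i <= y i)%N &
    forall i, (bump_coord a y i <= x i + (i \in A))%N].
Proof.
elim: fs A x => // g fs IH A x /=.
move=> nz ffs.
have [a aA] : exists2 a, a \in A & incr g a x * cup fs (A :\ a) (bump_coord a x) != 0.
  apply/exists_inP; apply: contra_neqT nz => /exists_inPn h; apply: big1 => a aA.
  by have := h a aA; rewrite negbK => /eqP.
have [->|gnz] := eqVneq (incr g a x) 0; first by rewrite mul0r eqxx.
have [->|cnz _] := eqVneq (cup fs (A :\ a) (bump_coord a x)) 0; first by rewrite mulr0 eqxx.
move: ffs; rewrite in_cons => /orP[/eqP ->|ffs].
  exists x, a; split => [|//|i].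
    by apply: contra_neq gnz; rewrite /incr => ->; rewrite addKK.
  by rewrite /bump_coord leq_add2l; case: eqVneq => // ->; rewrite aA.
have [y [b [h1 h2 h3]]] := IH _ _ cnz ffs; exists y, b; split=> // i.
  by apply: leq_trans (h2 i); rewrite leq_addr.
apply: leq_trans (h3 i) _; rewrite /bump_coord !inE -addnA leq_add2l.
by case: eqVneq => [->|]; rewrite ?aA.
Qed.

Variable f : 'I_d -> pt -> K.
Hypothesis f_0 : forall i y, y i = 0%N -> f i y = 0.
Hypothesis f_k : forall i y, y i = k -> f i y = 1.

(** Discrete Stokes formula. After [cup_exact] and telescoping, the sum becomes a sum
over faces. A face orthogonal to a direction other than the first one contributes
nothing, because the factor attached to that direction is constant on it; of the
two faces orthogonal to the first direction only the one where that factor is 1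
survives, and it carries the same sum in one dimension less. *)
Lemma boxsum_cup s x : uniq s -> boxsum s (cup (map f s) [set i in s]) x = 1.
Proof.
elim: s x => [//|a s IH] x us.
have [as_ us'] : a \notin s /\ uniq s by apply/andP.
rewrite -[map f (a :: s)]/(f a :: map f s) (eq_boxsum _ _ (cup_exact _ _ _)) boxsum_sum.
have aA : a \in [set i in a :: s] by rewrite inE mem_head.
rewrite (bigD1 a)// big1 ?[LHS]addr0; last first.
  move=> b /andP[]; rewrite inE => bs ba; rewrite (boxsum_incr _ _ us bs).
  apply: boxsum0 => y.
  have fb : f b \in map f s.
    by apply: map_f; move: bs; rewrite in_cons (negbTE ba).
  rewrite (@cup_const _ _ _ b _ 1 fb) ?inE ?eqxx//; last first.
    by move=> z; rewrite {1}/set_coord eqxx => /f_k.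
  rewrite (@cup_const _ _ _ b _ 0 fb) ?inE ?eqxx//; last first.
    by move=> z; rewrite {1}/set_coord eqxx => /f_0.
  by rewrite !mulr0 addr0.
rewrite boxsum_incr ?mem_head//= eqxx.
rewrite -(IH (set_coord x a k) us') -boxsum_set//; apply: eq_boxsum => y.
rewrite f_k ?{1}/set_coord ?eqxx// f_0 ?/set_coord ?eqxx// mul1r mul0r addr0.
congr cup; apply/setP => i; rewrite !inE; case: eqVneq => //= ->.
by rewrite (negbTE as_).
Qed.

End Cochain.

(** A cell on which all labels change exists because the mod 2 count of [boxsum_cup]
is 1. *)
Lemma discrete_Miranda (d k : nat) (f : 'I_d -> ('I_d -> nat) -> bool) :
  (forall i y, y i = 0%N -> f i y = false) ->
  (forall i y, y i = k -> f i y = true) ->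
  exists z : 'I_d -> nat, (forall i, z i < k)%N /\
   forall i, exists y y', [/\ f i y, ~~ f i y',
     (forall j, z j <= y j <= z j + 1)%N & (forall j, z j <= y' j <= z j + 1)%N].
Proof.
move=> f0 fk.
pose g (i : 'I_d) y : 'F_2 := (f i y)%:R.
have two (x : 'F_2) : x + x = 0 by apply: addrr_pchar2; apply: pchar_Fp.
have k0 : (0 < d)%N -> (0 < k)%N.
  by case: d f f0 fk {g} => // n f f0 fk _; case: k fk => // /(_ ord0 (fun=> 0%N) erefl); rewrite f0.
have g0 i y : y i = 0%N -> g i y = 0 by rewrite /g => /f0 ->.
have gk i y : y i = k -> g i y = 1 by rewrite /g => /fk ->.
have nz : boxsum k (enum 'I_d) (cup (map g (enum 'I_d)) [set i in enum 'I_d]) (fun=> 0%N) != 0.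
  by rewrite (boxsum_cup two g0 gk) ?enum_uniq// oner_neq0.
have [z [zk _ cz]] := boxsum_neq0 (enum_uniq _) nz.
exists z; split=> [i|i]; first by apply: zk; rewrite mem_enum.
have gi : g i \in map g (enum 'I_d) by apply: map_f; rewrite mem_enum.
have [y [a [ne ly uy]]] := cup_neq0 two cz gi.
have b1 j : (z j <= y j <= z j + 1)%N.
  rewrite ly /=; apply: leq_trans (leq_trans (uy j) _); first by rewrite /bump_coord leq_addr.
  by rewrite leq_add2l leq_b1.
have b2 j : (z j <= bump_coord a y j <= z j + 1)%N.
  rewrite (leq_trans (uy j)) ?leq_add2l ?leq_b1// andbT.
  by apply: leq_trans (ly j) _; rewrite leq_addr.
move: ne; rewrite /g; case fy: (f i y); case fy': (f i (bump_coord a y)); rewrite ?eqxx// => _.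
  by exists y, (bump_coord a y); rewrite fy fy'.
by exists (bump_coord a y), y; rewrite fy fy'.
Qed.

(** * The Poincare-Miranda theorem and outward fields *)

Section Miranda.
Local Open Scope classical_set_scope.
Variables (R : realType) (d : nat).
Implicit Types (x u v : 'rV[R]_d).

Lemma Miranda_approx (F : 'I_d -> 'rV[R]_d -> R) (B : R) (k : nat) :
  0 < B ->
  (forall i x, (forall j, - B <= x 0 j <= B) -> x 0 i = - B -> F i x <= 0) ->
  (forall i x, (forall j, - B <= x 0 j <= B) -> x 0 i = B -> 0 <= F i x) ->
  exists z : 'rV[R]_d, (forall j, - B <= z 0 j <= B) /\
    forall i, exists u u' : 'rV[R]_d, [/\ 0 <= F i u, F i u' <= 0,
      `|z - u| <= 2 * B / k.+1%:R & `|z - u'| <= 2 * B / k.+1%:R].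
Proof.
move=> B0 FN FP.
(* With k.+1 steps per side the mesh is well defined for every k. *)
pose gp (y : 'I_d -> nat) : 'rV[R]_d := \row_i (- B + 2 * B / k.+1%:R * (y i)%:R).
have k0 : 0 < k.+1%:R :> R by rewrite ltr0n.
have c0 : 0 <= 2 * B / k.+1%:R by apply: divr_ge0; rewrite ?ler0n// mulr_ge0// ltW.
have gpE y i : gp y 0 i = - B + 2 * B / k.+1%:R * (y i)%:R by rewrite mxE.
have gpB y : (forall j, y j <= k.+1)%N -> forall j, - B <= gp y 0 j <= B.
  move=> yk j; rewrite gpE lerDl mulr_ge0 ?ler0n//=.
  rewrite -lerBrDl opprK (_ : B + B = 2 * B / k.+1%:R * k.+1%:R); last first.
    by rewrite divfK ?gt_eqF//; ring.
  by apply: ler_wpM2l => //; rewrite ler_nat.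
(* On the faces the labels are imposed: the field may vanish there. *)
pose f i (y : 'I_d -> nat) :=
  if y i == 0%N then false else if y i == k.+1 then true else 0 < F i (gp y).
have [z [zk zf]] : exists z : 'I_d -> nat, (forall i, z i < k.+1)%N /\
   forall i, exists y y', [/\ f i y, ~~ f i y',
     (forall j, z j <= y j <= z j + 1)%N & (forall j, z j <= y' j <= z j + 1)%N].
  by apply: discrete_Miranda => i y; rewrite /f => -> /=; rewrite ?eqxx.
have dist y : (forall j, z j <= y j <= z j + 1)%N ->
    `|gp z - gp y| <= 2 * B / k.+1%:R.
  move=> yz; rewrite [leLHS]mx_normrE; apply/bigmax_leP; split=> // -[i0 i] _ /=.
  rewrite (ord1 i0) !mxE.
  have /andP[l1 l2] := yz i.
  rewrite [X in `|X|](_ : _ = 2 * B / k.+1%:R * - ((y i)%:R - (z i)%:R)); last by ring.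
  rewrite normrM normrN (ger0_norm c0) -[leRHS]mulr1; apply: ler_wpM2l => //.
  rewrite -natrB// (ger0_norm (ler0n _ _)) lern1.
  by rewrite leq_subLR.
have leK y : (forall j, z j <= y j <= z j + 1)%N -> forall j, (y j <= k.+1)%N.
  move=> yz j; have /andP[_ h] := yz j; apply: leq_trans h _.
  by rewrite addn1 zk.
exists (gp z); split=> [|i].
  by apply: gpB => j; apply: ltnW.
have [y [y' [fy fy' yz yz']]] := zf i.
exists (gp y), (gp y'); split; [| |exact: dist|exact: dist].
- move: fy; rewrite /f; case: eqP => // _; case: eqP => [yk _|_ /ltW//].
  apply: FP => [|]; first exact/gpB/leK.
  rewrite gpE yk divfK ?gt_eqF//; lra.
- move: fy'; rewrite /f; case: eqP => [y0 _|_].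
    apply: FN; first exact/gpB/leK.
    by rewrite gpE y0 mulr0 addr0.
  by case: eqP => // _; rewrite -leNgt.
Qed.

(** The cells of ever finer grids accumulate at a point where no coordinate of the
field can be nonzero. *)
Lemma Miranda (F : 'I_d -> 'rV[R]_d -> R) (B : R) :
  0 < B -> (forall i, continuous (F i)) ->
  (forall i x, (forall j, - B <= x 0 j <= B) -> x 0 i = - B -> F i x <= 0) ->
  (forall i x, (forall j, - B <= x 0 j <= B) -> x 0 i = B -> 0 <= F i x) ->
  exists x, forall i, F i x = 0.
Proof.
move=> B0 Fc FN FP.
have [z zP] := choice (fun k => Miranda_approx k B0 FN FP).
pose A := [set v : 'rV[R]_d | forall i, `[- B, B]%classic (v ord0 i)].
have Ac : compact A by apply: (@rV_compact _ _ (fun=> `[- B, B]%classic)) => _; apply: segment_compact.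
have [x [_ clx]] : A `&` cluster (z @ \oo) !=set0.
  apply: Ac; exists 0%N => // k _ i /=; rewrite in_itv/=.
  by have [h _] := zP k; apply: h.
exists x => i; apply/eqP; apply/negP => /negP Fx0.
have [e e0 He] : exists2 e : R, 0 < e & forall u, `|x - u| < e ->
    (0 < F i x -> 0 < F i u) /\ (F i x < 0 -> F i u < 0).
  have : \forall u \near x, `|F i x - F i u| < `|F i x|.
    have := Fc i x; move/cvgrPdist_lt; apply; by rewrite normr_gt0.
  move=> /nbhs_ballP[e e0 He]; exists e => // u xu.
  have := He u; rewrite mx_norm_ball => /(_ xu) /=.
  case: (ltrgt0P (F i x)) Fx0 => // _ _; rewrite ltr_norml => /andP[]; lra.
pose K := Num.truncn (4 * B / e).
have [v [[k /= Kk zkv]]] : [set z k | k in [set k | (K <= k)%N]] `&` ball x (e / 2) !=set0.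
  apply: clx.
    by exists K => // k /= Kk; exists k.
  by apply: nbhsx_ballx; rewrite divr_gt0.
rewrite mx_norm_ball /= -zkv /ball_ /= => xz.
have step : 2 * B / k.+1%:R < e / 2.
  have h : 4 * B / e < K.+1%:R by rewrite /K; apply: truncnS_gt.
  rewrite ltr_pdivrMr// in h.
  have h2 : K.+1%:R * e <= k.+1%:R * e by apply: ler_wpM2r; rewrite ?ler_nat ?ltnS// ltW.
  by rewrite ltr_pdivrMr ?ltr0n//; lra.
have [u [u' [Fu Fu' zu zu']]] := (zP k).2 i.
have near (w : 'rV[R]_d) : `|z k - w| <= 2 * B / k.+1%:R -> `|x - w| < e.
  move=> zw; have h := ler_distD (z k) x w.
  apply: le_lt_trans h _; rewrite [ltRHS]splitr.
  by apply: ltrD => //; exact: le_lt_trans zw step.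
have [h1 _] := He _ (near _ zu'); have [_ h2] := He _ (near _ zu).
case: (ltrgt0P (F i x)) Fx0 => // s _.
- by have := h1 s; rewrite ltNge Fu'.
- by have := h2 s; rewrite ltNge Fu.
Qed.

Definition dot (x y : 'rV[R]_d) : R := \sum_j x 0 j * y 0 j.

Lemma dotC x (y : 'rV[R]_d) : dot x y = dot y x.
Proof. by apply: eq_bigr => j _; rewrite mulrC. Qed.

Lemma dotDr x (y : 'rV[R]_d) u : dot x (y + u) = dot x y + dot x u.
Proof. by rewrite -big_split; apply: eq_bigr => j _; rewrite mxE mulrDr. Qed.

Lemma dotZr c x (y : 'rV[R]_d) : dot x (c *: y) = c * dot x y.
Proof. by rewrite mulr_sumr; apply: eq_bigr => j _; rewrite mxE mulrCA. Qed.

Lemma dot0r x : dot x 0 = 0.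
Proof. by apply: big1 => j _; rewrite mxE mulr0. Qed.

Lemma dot_sumr (T : Type) (r : seq T) (P : pred T) (f : T -> 'rV[R]_d) x :
  dot x (\sum_(t <- r | P t) f t) = \sum_(t <- r | P t) dot x (f t).
Proof. by apply: (big_morph (dot x)) => [u v|]; [exact: dotDr|exact: dot0r]. Qed.

Lemma dot_ge0 x : 0 <= dot x x.
Proof. by apply: sumr_ge0 => j _; rewrite -expr2 sqr_ge0. Qed.

Lemma dot_eq0 x : (dot x x == 0) = (x == 0).
Proof.
apply/idP/eqP => [|->]; last by rewrite dot0r.
rewrite psumr_eq0 => [/allP h|j _]; last by rewrite -expr2 sqr_ge0.
apply/rowP => j; have /eqP := h j (mem_index_enum _).
by rewrite mxE -expr2 => /eqP; rewrite sqrf_eq0 => /eqP.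
Qed.

Lemma coord_le_norm x j : `|x 0 j| <= `|x|.
Proof.
rewrite [leRHS]mx_normrE; apply/bigmax_geP; right.
by exists (0, j).
Qed.

Lemma dot_le_norm x u : `|dot x u| <= d%:R * `|x| * `|u|.
Proof.
apply: le_trans (ler_norm_sum _ _ _) _.
apply: (@le_trans _ _ (\sum_(j < d) `|x| * `|u|)).
  by apply: ler_sum => j _; rewrite normrM ler_pM// coord_le_norm.
by rewrite sumr_const card_ord -(mulr_natl (_ * _)) mulrA.
Qed.

End Miranda.

Section Continuity.
Variables (R : realType) (T : topologicalType).
Implicit Types f g : T -> R.

Lemma cts_sum (I : Type) (r : seq I) (P : pred I) (F : I -> T -> R) :
  (forall i, P i -> continuous (F i)) ->
  continuous (fun x => \sum_(i <- r | P i) F i x).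
Proof. by apply: continuous_big; exact: add_continuous. Qed.

Lemma ctsM f g : continuous f -> continuous g -> continuous (fun x => f x * g x).
Proof. by move=> cf cg x; apply: cvgM; [exact: cf|exact: cg]. Qed.

Lemma ctsD f g : continuous f -> continuous g -> continuous (fun x => f x + g x).
Proof. by move=> cf cg x; apply: cvgD; [exact: cf|exact: cg]. Qed.

Lemma ctsN f : continuous f -> continuous (fun x => - f x).
Proof. by move=> cf x; apply: cvgN; exact: cf. Qed.

Lemma cts_cst (c : R) : continuous (fun _ : T => c).
Proof. by move=> x; exact: cvg_cst. Qed.

Lemma cts_prod (I : Type) (r : seq I) (P : pred I) (F : I -> T -> R) :
  (forall i, P i -> continuous (F i)) ->
  continuous (fun x => \prod_(i <- r | P i) F i x).
Proof. by apply: continuous_big; exact: mul_continuous. Qed.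

Lemma cts_max0 f : continuous f -> continuous (fun x => Num.max 0 (f x)).
Proof.
move=> cf x; apply: (@continuous_max R T (fun=> 0) f); last exact: cf.
exact: cvg_cst.
Qed.

Lemma cts_norm f : continuous f -> continuous (fun x => `|f x|).
Proof. by move=> cf x; apply: cvg_norm; exact: cf. Qed.

End Continuity.

Section OutwardField.
Variables (R : realType) (d : nat).
Implicit Types (x : 'rV[R]_d).

Lemma cts_coord j : continuous (fun x => x 0 j).
Proof. exact: coord_continuous. Qed.

Lemma cts_dot u : continuous (fun x => dot u x).
Proof.
apply: cts_sum => j _; apply: ctsM; [exact: cts_cst|exact: cts_coord].
Qed.

Lemma cts_dotxx : continuous (fun x => dot x x).
Proof. by apply: cts_sum => j _; apply: ctsM; exact: cts_coord. Qed.

(** Brouwer's theorem. Adding a large multiple of [x] outside the ball of squared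
radius [rho] creates no zero, the field being outward there, and produces the sign
pattern of [Miranda] on the boundary of a cube. *)
Lemma outward_field_has_zero (G : 'rV[R]_d -> 'rV[R]_d) (rho : R) :
  0 <= rho -> (forall j, continuous (fun x => G x 0 j)) ->
  (forall x, rho <= dot x x -> 0 < dot x (G x)) ->
  exists x, G x = 0.
Proof.
move=> rho0 Gc Gout.
pose kappa x := Num.max 0 (dot x x - rho) * (1 + \sum_j `|G x 0 j|).
pose F i x := G x 0 i + kappa x * x 0 i.
have F0 x : 0 <= kappa x.
  by rewrite mulr_ge0 ?le_max ?lexx// addr_ge0// sumr_ge0.
have Fc i : continuous (F i).
  apply: ctsD => //; apply: ctsM; last exact: cts_coord.
  apply: ctsM.
    by apply: cts_max0; apply: ctsD; [exact: cts_dotxx|exact: cts_cst].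
  by apply: ctsD; [exact: cts_cst|apply: cts_sum => j _; exact: cts_norm].
have kappaB x i : `|x 0 i| = rho + 1 -> 1 + `|G x 0 i| <= kappa x.
  move=> xi; have h : (rho + 1) ^+ 2 <= dot x x.
    rewrite -xi real_normK ?num_real// /dot (bigD1 i)//= expr2 lerDl.
    by apply: sumr_ge0 => j _; rewrite -expr2 sqr_ge0.
  have h1 : 1 <= Num.max 0 (dot x x - rho).
    by rewrite le_max; apply/orP; right; nra.
  have h2 : `|G x 0 i| <= \sum_j `|G x 0 j|.
    by rewrite (bigD1 i)//= lerDl sumr_ge0.
  have h3 : 0 <= `|G x 0 i| by [].
  by rewrite /kappa; nra.
have B0 : 0 < rho + 1 by lra.
have [||x xF] := @Miranda R d F (rho + 1) B0 Fc.
- move=> i x _ xi; have := kappaB x i; rewrite xi normrN gtr0_norm// => /(_ erefl) h.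
  rewrite /F xi; move: (G x 0 i) (kappa x) h (F0 x) => g k h k0.
  have := ler_norm g; have := mulr_ge0 k0 rho0; lra.
- move=> i x _ xi; have := kappaB x i; rewrite xi gtr0_norm// => /(_ erefl) h.
  rewrite /F xi; move: (G x 0 i) (kappa x) h (F0 x) => g k h k0.
  have : - `|g| <= g by rewrite lerNl -normrN ler_norm.
  have := mulr_ge0 k0 rho0; lra.
exists x; apply/rowP => i; rewrite mxE.
have k0 : kappa x = 0.
  rewrite /kappa; case: (leP rho (dot x x)) => [h|/ltW h]; last first.
    by rewrite max_l ?mul0r// subr_le0.
  have := Gout x h.
  rewrite /dot (eq_bigr (fun j => - kappa x * (x 0 j * x 0 j))); last first.
    by move=> j _; have := xF j; rewrite /F => /eqP; rewrite addr_eq0 => /eqP ->; ring.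
  rewrite -mulr_sumr mulNr oppr_gt0 -/(dot x x) ltNge => /negP[].
  by rewrite mulr_ge0// dot_ge0.
by have := xF i; rewrite /F k0 mul0r addr0.
Qed.

End OutwardField.

(** * An outward field that never approaches a hyperplane *)

Section Recession.
Variables (R : realType) (d : nat) (I : finType).
Variables (a : I -> 'rV[R]_d) (b : I -> R).
Implicit Types (x u v : 'rV[R]_d) (Q : 'M[R]_d).

Definition aff i x := dot (a i) x - b i.

(** Orthogonal projections, acting on row vectors from the right. *)
Definition orthoproj Q :=
  (forall x (y : 'rV[R]_d), dot x (y *m Q) = dot (x *m Q) y) /\
  (forall x, x *m Q *m Q = x *m Q).

(** One Gram-Schmidt step: the projection onto the vectors of the image of [Q] that are
orthogonal to the normal [a i]. *)
Definition proj_step Q (i : I) : 'M[R]_d :=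
  let e := a i *m Q in Q - (dot e e)^-1 *: (e^T *m e).

Lemma proj_stepE Q i x :
  x *m proj_step Q i =
  x *m Q - (dot x (a i *m Q) / dot (a i *m Q) (a i *m Q)) *: (a i *m Q).
Proof.
rewrite /proj_step mulmxBr -scalemxAr; move: (a i *m Q) => e; congr (_ - _).
have xe : x *m e^T = (dot x e)%:M.
  apply/matrixP => j k; rewrite !mxE (ord1 j) (ord1 k) eqxx mulr1n.
  by apply: eq_bigr => l _; rewrite !mxE.
by rewrite mulmxA xe mul_scalar_mx scalerA mulrC.
Qed.

Lemma dotBr x u v : dot x (u - v) = dot x u - dot x v.
Proof. by rewrite dotDr -scaleN1r dotZr mulN1r. Qed.

Lemma orthoproj_step Q i : orthoproj Q -> orthoproj (proj_step Q i).
Proof.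
move=> [sym idem]; set e := a i *m Q.
have eQ : e *m Q = e by rewrite idem.
have ee : e *m proj_step Q i = 0.
  rewrite proj_stepE -/e eQ; have [->|e0] := eqVneq e 0; first by rewrite scaler0 subrr.
  by rewrite divff ?dot_eq0// scale1r subrr.
have xQ x : dot (x *m Q) e = dot x e by rewrite -sym eQ.
split=> [x y|x].
  rewrite !proj_stepE -/e [RHS]dotC !dotBr !dotZr sym [dot _ (x *m Q)]dotC.
  by rewrite (dotC x e) (dotC y e); congr (_ - _); ring.
rewrite [x *m proj_step _ _]proj_stepE -/e mulmxBl -scalemxAl ee scaler0 subr0.
by rewrite proj_stepE -/e xQ idem.
Qed.

Lemma proj_step_ker Q i : orthoproj Q -> a i *m proj_step Q i = 0.
Proof.
move=> [sym idem]; rewrite proj_stepE.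
have [->|e0] := eqVneq (a i *m Q) 0; first by rewrite scaler0 subrr.
have -> : dot (a i) (a i *m Q) = dot (a i *m Q) (a i *m Q).
  by rewrite -[X in dot _ X = _]idem sym.
by rewrite divff ?dot_eq0// scale1r subrr.
Qed.

Lemma proj_step_ker_sub Q i j : orthoproj Q ->
  a j *m Q = 0 -> a j *m proj_step Q i = 0.
Proof.
move=> [sym idem] aj; rewrite proj_stepE aj.
have -> : dot (a j) (a i *m Q) = 0 by rewrite sym aj dotC dot0r.
by rewrite mul0r scale0r subrr.
Qed.

(** Finitely many projections, onto directions parallel to some of the hyperplanes;
the parameter [n] bounds the number of Gram-Schmidt steps. *)
Fixpoint proj_closure n Q : seq 'M[R]_d :=
  if n is n'.+1 then
    Q :: flatten [seq proj_closure n' (proj_step Q i) | i <- enum I]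
  else [:: Q].

Lemma orthoproj_closure n Q : orthoproj Q ->
  forall Q', Q' \in proj_closure n Q -> orthoproj Q'.
Proof.
elim: n Q => [|n IH] Q pQ Q' /=; first by rewrite inE => /eqP ->.
rewrite in_cons => /orP[/eqP -> //|/flatten_mapP[i _]].
by apply: IH; exact: orthoproj_step.
Qed.

(** The direction [x *m Q] moves [x] strictly away from every hyperplane that is not
parallel to it. *)
Definition recessive Q x :=
  forall i, a i *m Q != 0 -> 0 < dot (a i *m Q) x * aff i x.

(** If [Q] fails at [x] because of hyperplane [i], then the component of [x] along
[a i *m Q] is controlled by the distance from [x] to [x *m Q]; projecting it away
moves [x] by a bounded amount and makes hyperplane [i] parallel. This can happen
at most once per hyperplane, so the final distance is bounded independently of
[x]. *)
Lemma recessive_exists n Q (M : R) : orthoproj Q ->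
  (#|[pred i | a i *m Q != 0%R]| <= n)%N ->
  exists M' : R, forall x, `|x - x *m Q| <= M ->
    exists Q', [/\ Q' \in proj_closure n Q, recessive Q' x & `|x - x *m Q'| <= M'].
Proof.
elim: n Q M => [|n IH] Q M pQ cQ.
  exists M => x xM; exists Q; split=> //=; first exact: mem_head.
  move=> i ai; move: cQ; rewrite leqn0 => /eqP/card0_eq/(_ i).
  by rewrite inE ai.
pose e i : 'rV[R]_d := a i *m Q.
pose del i := d%:R * `|a i| * M + `|b i|.
pose Mi i := M + del i / dot (e i) (e i) * `|e i|.
have /choice[g gP] : forall i, exists M' : R, e i != 0%R ->
   forall x, `|x - x *m proj_step Q i| <= Mi i ->
    exists Q', [/\ Q' \in proj_closure n (proj_step Q i), recessive Q' x &
      `|x - x *m Q'| <= M'].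
  move=> i; have [ei|ei] := eqVneq (e i) 0; first by exists 0%R.
  have [|M' HM'] := IH (proj_step Q i) (Mi i) (orthoproj_step i pQ); last by exists M'.
  rewrite -ltnS; apply: leq_trans cQ.
  apply: proper_card; apply/properP; split.
    apply/fintype.subsetP => j; rewrite !inE; apply: contra_neq.
    exact: proj_step_ker_sub.
  by exists i; rewrite inE// proj_step_ker// eqxx.
exists (M + \sum_i `|g i|) => x xM.
have M0 : 0 <= M by apply: le_trans xM.
case: (pselect (recessive Q x)) => [rQ|].
  exists Q; split=> //; first exact: mem_head.
  by apply: le_trans xM _; rewrite lerDl sumr_ge0.
move=> /existsNP[i /not_implyP[ei /negP]]; rewrite -leNgt -/(e i) in ei * => h.
have ee : 0 < dot (e i) (e i) by rewrite lt_neqAle eq_sym dot_eq0 ei dot_ge0.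
have [//|Q' [Q'c rQ' xQ']] := gP i ei x _.
  rewrite proj_stepE -/(e i) opprB addrCA addrC; apply: le_trans (ler_normD _ _) _.
  apply: lerD => //; rewrite normrZ; apply: ler_wpM2r => //.
  rewrite normrM (gtr0_norm (x := _^-1)) ?invr_gt0//; apply: ler_wpM2r; first by rewrite invr_ge0 ltW.
  have xe : dot x (e i) = dot (a i) (x *m Q) by rewrite dotC pQ.1.
  have E : aff i x = dot x (e i) + (dot (a i) (x - x *m Q) - b i).
    by rewrite /aff xe dotBr; ring.
  have D : `|dot (a i) (x - x *m Q) - b i| <= del i.
    apply: le_trans (ler_normB _ _) _; apply: lerD => //.
    apply: le_trans (dot_le_norm _ _) _; exact: ler_wpM2l.
  apply: le_trans D; move: h; rewrite dotC E.
  move: (dot x (e i)) (_ - b i) => p q pq.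
  rewrite ler_norml; have := ler_norm q; have : - `|q| <= q by rewrite lerNl -normrN ler_norm.
  move=> ? ?.
  by apply/andP; split; nra.
exists Q'; split=> //.
  rewrite in_cons; apply/orP; right; apply/flatten_mapP.
  by exists i; rewrite ?mem_enum.
apply: le_trans xQ' _; apply: le_trans (ler_norm _) _.
by rewrite (bigD1 i)//= addrCA lerDl addr_ge0// sumr_ge0.
Qed.

(** Outside a large ball some recessive [Q] has a nonzero [x *m Q], since the distance
from [x] to [x *m Q] is bounded. The weights vanish exactly when [Q] stops being
recessive, which makes the combination continuous. *)
Lemma recessive_field : exists (n : 'rV[R]_d -> 'rV[R]_d) (rho : R),
  [/\ 0 <= rho, forall j, continuous (fun x => n x 0 j),
    forall i x, 0 <= aff i x * dot (a i) (n x) &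
    forall x, rho <= dot x x -> 0 < dot x (n x)].
Proof.
have p1 : orthoproj 1%:M by split=> [x y|x]; rewrite !mulmx1.
have [M HM] := @recessive_exists #|I| 1%:M 0 p1 (max_card _).
pose Qs := proj_closure #|I| 1%:M.
have pQ Q : Q \in Qs -> orthoproj Q by apply: orthoproj_closure.
pose chi Q x := \prod_(i | a i *m Q != 0) Num.max 0 (dot (a i *m Q) x * aff i x).
have chi0 Q x : 0 <= chi Q x by apply: prodr_ge0 => i _; rewrite le_max lexx.
pose n x := \sum_(Q <- Qs) chi Q x *: (x *m Q).
have nE j x : n x 0 j = \sum_(Q <- Qs) chi Q x * dot (\row_k Q k j) x.
  rewrite summxE; apply: eq_bigr => Q _; rewrite !mxE; congr (_ * _).
  by apply: eq_bigr => k _; rewrite !mxE mulrC.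
exists n, (d%:R * (`|M| * `|M|) + 1); split.
- by rewrite addr_ge0// !mulr_ge0.
- move=> j; rewrite (_ : (fun x => _) = (fun x => \sum_(Q <- Qs) chi Q x * dot (\row_k Q k j) x)); last exact: funext.
  apply: cts_sum => Q _; apply: ctsM; last exact: cts_dot.
  apply: cts_prod => i _; apply: cts_max0; apply: ctsM; first exact: cts_dot.
  by apply: ctsD; [exact: cts_dot|exact: cts_cst].
- move=> i x; rewrite dot_sumr mulr_sumr big_seq; apply: sumr_ge0 => Q QQs.
  rewrite dotZr (pQ Q QQs).1 mulrCA.
  have [->|ai] := eqVneq (a i *m Q) 0; first by rewrite (dotC 0) dot0r !mulr0.
  case: (leP 0 (aff i x * dot (a i *m Q) x)) => [h|h]; first by rewrite mulr_ge0.
  by rewrite /chi (bigD1 i)//= [dot _ _ * _]mulrC max_l ?mul0r// ltW.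
- move=> x rx.
  have [|Q [QQs rQ xQ]] := HM x _; first by rewrite mulmx1 subrr normr0.
  rewrite dot_sumr big_seq (big_rem Q QQs)/= QQs.
  have dxQ Q' : Q' \in Qs -> dot x (x *m Q') = dot (x *m Q') (x *m Q').
    by move=> /pQ [sym idem]; rewrite -{1}idem sym.
  apply: ltr_pwDl; last first.
    by apply: sumr_ge0 => Q' /dxQ e; rewrite dotZr e mulr_ge0// dot_ge0.
  rewrite dotZr dxQ// mulr_gt0//.
    apply: prodr_gt0 => i ai; rewrite lt_max; apply/orP; right; exact: rQ.
  rewrite lt_neqAle eq_sym dot_eq0 dot_ge0 andbT; apply/eqP => xQ0.
  move: xQ; rewrite xQ0 subr0 => xM.
  have h := le_trans (ler_norm _) (dot_le_norm x x).
  have xM1 : `|x| <= `|M| by apply: le_trans xM (ler_norm _).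
  have : d%:R * `|M| * `|M| < d%:R * `|x| * `|x|.
    by apply: lt_le_trans (le_trans rx h); rewrite -mulrA ltrDl.
  apply/negP; rewrite -leNgt -!mulrA; apply: ler_wpM2l => //.
  by apply: ler_pM.
Qed.

End Recession.

(** * Common points of hulls and covering families of rays *)

Section Escape.
Variables (R : realType) (d : nat) (I T : finType).
Variables (a : I -> 'rV[R]_d) (b : I -> R) (Y : T -> {set I}).
Implicit Types (x v : 'rV[R]_d).

Let pattern x : {set I} * {set I} :=
  ([set i | 0 < aff a b i x], [set i | aff a b i x < 0])%SET.

(** If no point is common to the hulls, a direction of escape and its label are chosen
once for each sign vector of the arrangement. They remain valid at all points with
the same strict signs, so that the products [phi] of positive parts glue them
into a continuous field, cut off by [eta] where the recessive field takes over.
The directions [v j] collect, at a zero, the terms with label [j]. *)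
Lemma common_hull_or_escape :
  (exists x, forall j v, exists2 i, i \in Y j & aff a b i x * dot (a i) v <= 0) \/
  (exists x (J : {set T}) (v : T -> 'rV[R]_d),
    (forall j i, j \in J -> i \in Y j -> 0 < aff a b i x * dot (a i) (v j)) /\
    (forall i, exists2 j, j \in J & aff a b i x * dot (a i) (v j) <= 0)).
Proof.
case: (pselect (exists x, forall j v,
  exists2 i, i \in Y j & aff a b i x * dot (a i) v <= 0)) => [?|/forallNP bad]; first by left.
right.
have {bad} /choice[jv jvP] : forall x, exists jv : T * 'rV[R]_d,
    forall i, i \in Y jv.1 -> 0 < aff a b i x * dot (a i) jv.2.
  move=> x; have /existsNP[j /existsNP[v h]] := bad x; exists (j, v) => i iY.
  by rewrite ltNge; apply/negP => le0; apply: h; exists i.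
have [n [rho [rho0 nc nsgn nout]]] := recessive_field a b.
have /choice[rep repP] : forall s, exists x,
    (exists y, pattern y = s) -> pattern x = s.
  by move=> s; case: (pselect (exists y, pattern y = s)) => [[y]|h]; [exists y|exists 0].
pose real s := `[<exists y, pattern y = s>].
pose phi (s : {set I} * {set I}) x := \prod_(i in s.1) Num.max 0 (aff a b i x) *
  \prod_(i in s.2) Num.max 0 (- aff a b i x).
have phi_ge0 s x : 0 <= phi s x.
  by rewrite mulr_ge0//; apply: prodr_ge0 => i _; rewrite le_max lexx.
pose lab s := (jv (rep s)).1; pose dir s := (jv (rep s)).2.
pose w x := \sum_(s | real s) phi s x *: dir s.
pose eta x := Num.max 0 (rho - dot x x).
pose G x := n x + eta x *: w x.
have affc i : continuous (aff a b i) by apply: ctsD; [exact: cts_dot|exact: cts_cst].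
have Gc j : continuous (fun x => G x 0 j).
  rewrite (_ : (fun x => _) = (fun x => n x 0 j + eta x * \sum_(s | real s) phi s x * dir s 0 j)); last first.
    apply: funext => x; rewrite /G !mxE summxE; congr (_ + _ * _).
    by apply: eq_bigr => s _; rewrite mxE.
  apply: ctsD => //; apply: ctsM.
    apply: cts_max0; apply: ctsD; first exact: cts_cst.
    by apply: ctsN; exact: cts_dotxx.
  apply: cts_sum => s _; apply: ctsM; last exact: cts_cst.
  by apply: ctsM; apply: cts_prod => i _; apply: cts_max0 => //; apply: ctsN.
have Gout x : rho <= dot x x -> 0 < dot x (G x).
  by move=> h; rewrite /G /eta max_l ?subr_le0// scale0r addr0 nout.
have [x Gx0] := outward_field_has_zero rho0 Gc Gout.
have ltx : dot x x < rho.
  by rewrite ltNge; apply/negP => h; have := Gout x h; rewrite Gx0 dot0r ltxx.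
have eta0 : 0 < eta x by rewrite /eta lt_max subr_gt0 ltx orbT.
have escape s i : real s -> 0 < phi s x -> i \in Y (lab s) ->
    0 < aff a b i x * dot (a i) (dir s).
  move=> rs phis iY; have rep_s : pattern (rep s) = s by apply: repP; apply/asboolP.
  have := jvP (rep s) i iY; rewrite -/(dir s).
  have pos k : k \in s.1 -> 0 < aff a b k x.
    move=> ks; rewrite ltNge; apply/negP => le0; move: phis.
    by rewrite /phi (bigD1 k)//= max_l// !mul0r ltxx.
  have neg k : k \in s.2 -> aff a b k x < 0.
    move=> ks; rewrite ltNge; apply/negP => le0; move: phis.
    by rewrite /phi [X in _ * X](bigD1 k)//= max_l ?oppr_le0// mul0r mulr0 ltxx.
  case: (ltrgt0P (aff a b i (rep s))) => [h|h|->]; last by rewrite mul0r ltxx.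
  - have /pos h2 : i \in s.1 by rewrite -rep_s inE.
    by rewrite !pmulr_rgt0.
  - have /neg h2 : i \in s.2 by rewrite -rep_s inE.
    by rewrite !nmulr_rgt0.
pose J := [set j | [exists s, [&& real s, 0 < phi s x & lab s == j]]]%SET.
pose v j := \sum_(s | [&& real s, 0 < phi s x & lab s == j]) phi s x *: dir s.
have vpos j i : j \in J -> (forall s, real s -> 0 < phi s x -> lab s = j ->
    0 < aff a b i x * dot (a i) (dir s)) -> 0 < aff a b i x * dot (a i) (v j).
  rewrite inE => /existsP[s0 s0P] h.
  rewrite dot_sumr mulr_sumr (bigD1 s0)//=; apply: ltr_pwDl.
    by move: s0P => /and3P[? ? /eqP ?]; rewrite dotZr mulrCA mulr_gt0// h.
  apply: sumr_ge0 => s /andP[/and3P[? ? /eqP ?] _].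
  by rewrite dotZr mulrCA ltW// mulr_gt0// h.
have wE : w x = \sum_(j in J) v j.
  rewrite /w (bigID (fun s => 0 < phi s x))/= [X in _ + X]big1 ?addr0; last first.
    move=> s /andP[_]; rewrite -leNgt => h.
    by rewrite (_ : phi s x = 0) ?scale0r//; apply/eqP; rewrite eq_le h phi_ge0.
  rewrite (partition_big lab (mem J))/=; last first.
    by move=> s /andP[rs ps]; rewrite inE; apply/existsP; exists s; rewrite rs ps eqxx.
  by apply: eq_bigr => j _; apply: eq_bigl => s; rewrite andbA.
exists x, J, v; split=> [j i jJ iY|i].
  by apply: vpos => // s rs ps sj; apply: escape => //; rewrite sj.
apply: contrapT => noj.
have allpos j : j \in J -> 0 < aff a b i x * dot (a i) (v j).
  by move=> jJ; rewrite ltNge; apply/negP => h; apply: noj; exists j.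
have phix : 0 < phi (pattern x) x.
  rewrite mulr_gt0//; apply: prodr_gt0 => k; rewrite inE lt_max ?oppr_gt0 => ->;
    by rewrite orbT.
have rx : real (pattern x) by apply/asboolP; exists x.
have jx : lab (pattern x) \in J.
  by rewrite inE; apply/existsP; exists (pattern x); rewrite rx phix eqxx.
have : 0 < aff a b i x * dot (a i) (G x).
  rewrite /G dotDr mulrDr; apply: ltr_wpDl; first exact: nsgn.
  rewrite dotZr mulrCA mulr_gt0// wE dot_sumr mulr_sumr (bigD1 _ jx)/=.
  apply: ltr_pwDl; first exact: allpos.
  by apply: sumr_ge0 => j /andP[/allpos/ltW].
by rewrite Gx0 dot0r mulr0 ltxx.
Qed.

End Escape.

(** * Shattering: set systems and their cube edges *)

Section Shatter.
Import mathcomp.boot.fintype mathcomp.boot.finset.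
Variable J : finType.
Implicit Types (F : {set {set J}}) (S T U A : {set J}).

Definition shatters F S :=
  forall T, T \subset S -> exists2 U, U \in F & U :&: S = T.

Definition vc_le F d := forall S, shatters F S -> (#|S| <= d)%N.

Lemma vc_le_sub F F' d : F' \subset F -> vc_le F d -> vc_le F' d.
Proof.
move=> /subsetP F'F vF S sh; apply: vF => T TS.
by have [U UF' UT] := sh T TS; exists U => //; exact: F'F.
Qed.

(** Pairs of members of [F] that differ in one element, encoded by the smaller set and
that element. *)
Definition cube_edges F : {set {set J} * J} :=
  [set e | [&& e.1 \in F, e.2 \notin e.1 & e.2 |: e.1 \in F]].

Section Reduction.
Variables (F : {set {set J}}) (a : J).
Let F0 := [set U in F | a \notin U].
Let F1 := [set U : {set J} | (a \notin U) && (a |: U \in F)].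

(** Removing [a] from all members identifies those that differ only in [a]; the
intersection counts what is lost. *)
Lemma card_link_deletion : #|F| = (#|F0 :|: F1| + #|F0 :&: F1|)%N.
Proof.
rewrite cardsUI.
have inj : {in F1 &, injective (fun U => a |: U)}.
  move=> U V; rewrite !inE => /andP[aU _] /andP[aV _] UV.
  by rewrite -(setU1K aU) UV setU1K.
rewrite -(card_in_imset inj) -(cardsID [set U : {set J} | a \notin U] F); congr (_ + _)%N.
  by apply: eq_card => U; rewrite !inE.
apply: eq_card => U; rewrite !inE negbK; apply/andP/imsetP => [[aU UF]|[V]].
  by exists (U :\ a); rewrite ?inE ?eqxx ?setD1K.
by rewrite inE => /andP[_ VF ->]; rewrite setU11 VF.
Qed.

Lemma shatters_deletion S : shatters (F0 :|: F1) S -> shatters F S.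
Proof.
move=> sh T TS.
have aS : a \notin S.
  have [U] := sh S (subxx S); rewrite !inE => h /setIidPr /subsetP US.
  by case/orP: h => /andP[h1 h2]; apply/negP => /US; apply/negP.
have [U] := sh T TS; rewrite !inE => /orP[/andP[UF _] <-|/andP[aU UF] <-].
  by exists U.
exists (a |: U) => //; apply/setP => x; rewrite !inE.
by case: eqP => // ->; rewrite (negbTE aS) !andbF.
Qed.

(** Both choices for [a] are available over a set of the link, so shattering gains a
point. *)
Lemma shatters_link S : shatters (F0 :&: F1) S -> a \notin S /\ shatters F (a |: S).
Proof.
move=> sh; have aS : a \notin S.
  have [U] := sh S (subxx S); rewrite !inE => /andP[/andP[_ aU] _] /setIidPr /subsetP US.
  by apply/negP => /US; apply/negP.
split=> // T TS.
have TS' : T :\ a \subset S by rewrite subDset.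
have [U] := sh _ TS'; rewrite !inE => /andP[/andP[UF aU] /andP[_ aUF]] UT.
case: (boolP (a \in T)) => aT.
  by exists (a |: U) => //; rewrite -setUIr UT setD1K.
exists U => //; move: UT; rewrite (setDidPl _) ?disjoints1 1?disjoint_sym ?disjoints1// => <-.
apply/setP => x; rewrite !inE.
by case: eqP => // ->; rewrite (negbTE aU).
Qed.

Lemma card_edges_deletion :
  (#|cube_edges F| <= #|F0 :&: F1| + #|cube_edges (F0 :|: F1)| + #|cube_edges (F0 :&: F1)|)%N.
Proof.
pose E0 := cube_edges F0; pose E1 := cube_edges F1.
have sub : cube_edges F \subset [set (U, a) | U in F0 :&: F1] :|: E0 :|:
    [set (a |: e.1, e.2) | e in E1].
  apply/subsetP => -[U k]; rewrite !inE /= => /and3P[UF kU kUF].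
  case: (boolP (a \in U)) => aU.
    apply/orP; right; apply/imsetP; exists (U :\ a, k) => /=; last by rewrite setD1K.
    rewrite !inE /= eqxx /= setD1K// UF/= (negbTE kU) andbF/=.
    have ka : k != a by apply: contraNneq kU => ->.
    by rewrite [a == k]eq_sym (negbTE ka)/= setUCA setD1K.
  case: (eqVneq k a) => [ka|ka].
    apply/orP; left; apply/orP; left; apply/imsetP; exists U; rewrite ?ka//.
    by rewrite !inE UF aU -ka.
  by rewrite UF kU kUF orbT.
apply: leq_trans (subset_leq_card sub) _.
apply: leq_trans (leq_card_setU _ _) _.
apply: leq_trans (leq_add (leq_card_setU _ _) (leq_imset_card _ _)) _.
rewrite -!addnA leq_add ?leq_imset_card// -(cardsUI E0 E1) leq_add// subset_leq_card//.
  apply/subsetP => -[U k]; rewrite !inE /= => /orP[|] /and3P[].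
    by move=> -> -> ->.
  by move=> -> -> ->; rewrite !orbT.
apply/subsetP => -[U k]; rewrite !inE /= => /andP[/and3P[] -> -> -> /and3P[] -> _ ->].
by [].
Qed.

End Reduction.

(** Both bounds follow by deleting one element: the deletion has the same dimension and
the link has dimension one less. An edge in the deleted direction is a member of
the link, and every other edge is an edge of the deletion or of the link. *)
Lemma sauer_shelah_haussler F A d : (forall U, U \in F -> U \subset A) -> vc_le F d ->
  (#|F| <= (#|A|.+1) ^ d)%N /\ (#|cube_edges F| <= d * #|F|)%N.
Proof.
elim: {A}#|A| {-2}A (erefl #|A|) F d => [|n IH] A cA F d FA vF.
  have F1 : (#|F| <= 1)%N.
    rewrite -(cards1 (set0 : {set J})) subset_leq_card//; apply/subsetP => U /FA.
    by rewrite (cards0_eq cA) subset0 inE.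
  rewrite cA exp1n; split=> //.
  rewrite (_ : cube_edges F = set0) ?cards0//; apply/setP => -[U k]; rewrite !inE /=.
  apply/negP => /and3P[_ _ /FA]; rewrite (cards0_eq cA) subset0 => /eqP/setP/(_ k).
  by rewrite !inE eqxx.
have [a aA] : exists a, a \in A by apply/card_gt0P; rewrite cA.
pose F0 := [set U in F | a \notin U].
pose F1 := [set U : {set J} | (a \notin U) && (a |: U \in F)].
have cA' : #|A :\ a| = n by move: cA; rewrite (cardsD1 a) aA => -[].
have sub U : U \in F0 :|: F1 -> U \subset A :\ a.
  rewrite !inE => /orP[|] /andP[]; rewrite subsetD1.
    by move=> /FA -> ->.
  move=> -> /FA; rewrite andbT => /subsetP h; apply/subsetP => x xU; apply: h.
  by rewrite !inE xU orbT.
have [c' e'] := IH _ cA' (F0 :|: F1) d sub (fun S sh => vF S (shatters_deletion sh)).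
have [F''0|[U0 U0F]] := set_0Vmem (F0 :&: F1).
  move: (card_link_deletion F a) (card_edges_deletion F a).
  rewrite -/F0 -/F1 F''0 cards0 addn0 add0n => -> cE.
  rewrite (_ : cube_edges set0 = set0) ?cards0 ?addn0 in cE; last first.
    by apply/setP => e; rewrite !inE.
  split; last exact: leq_trans cE e'.
  apply: leq_trans c' _; rewrite cA' cA.
  by case: (d) => // e; rewrite leq_exp2r.
have d0 : (0 < d)%N.
  have /shatters_link[_ /vF] : shatters (F0 :&: F1) set0.
    by move=> T; rewrite subset0 => /eqP ->; exists U0 => //; rewrite setI0.
  by rewrite setU0 cards1.
have vF'' : vc_le (F0 :&: F1) d.-1.
  move=> S /shatters_link[aS /vF]; rewrite cardsU1 aS add1n.
  by case: (d) d0.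
have sub'' U : U \in F0 :&: F1 -> U \subset A :\ a.
  by move=> h; apply: sub; move: h; rewrite !inE => /andP[->].
have [c'' e''] := IH _ cA' (F0 :&: F1) d.-1 sub'' vF''.
have cE := card_edges_deletion F a; have cF := card_link_deletion F a.
rewrite -/F0 -/F1 in cE cF.
move: c' c'' e' e''; rewrite cF cA cA' => c' c'' e' e''.
case: d d0 vF c' c'' e' e'' {vF''} => // d _ _ /= c' c'' e' e''; split.
  apply: leq_trans (leq_add c' c'') _.
  rewrite expnS [X in (_ <= X)%N]expnS -mulSnr.
  by rewrite leq_mul2l /=; case: (d) => // e; rewrite leq_exp2r.
apply: leq_trans cE _; rewrite mulnDr [(d.+1 * #|F0 :&: F1|)%N]mulSn.
apply: leq_trans (leq_add (leq_add (leqnn _) e') e'') _.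
by rewrite addnCA addnA.
Qed.

End Shatter.

(** * Haussler's packing lemma *)

Section Packing.
Import mathcomp.boot.fintype mathcomp.boot.finset.
Variables (R : realType) (I G : finType) (M : G -> I -> bool) (d : nat).
Implicit Types (A : {set I}) (g : G) (x y : I).

Definition trace s (c : 'I_s -> G) x : {set 'I_s} := [set j | M (c j) x].

(** The points of [I] induce sets of ranges, by recording which ranges contain them; it
is the dimension of this system, for ranges possibly repeated in a tuple, that
governs the packing of points. *)
Definition dual_vc_le := forall s (c : 'I_s -> G), vc_le [set trace c x | x : I] d.

Definition resample s (c : {ffun 'I_s -> G}) j g : {ffun 'I_s -> G} :=
  [ffun k => if k == j then g else c k].

Section Weights.
Variable mu : G -> R.
Hypothesis mu_ge0 : forall g, 0 <= mu g.
Hypothesis mu1 : \sum_g mu g = 1.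

(** The pseudo-distance between points given by the total weight of the ranges that
separate them. *)
Definition sep_weight x y := \sum_(g | M g x != M g y) mu g.

Let prob s (c : {ffun 'I_s -> G}) := \prod_k mu (c k).

Lemma prob_sum1 s : \sum_c @prob s c = 1.
Proof.
rewrite -(bigA_distr_bigA (fun=> mu)) big1// => k _; exact: mu1.
Qed.

Lemma prob_ge0 s (c : {ffun 'I_s -> G}) : 0 <= prob c.
Proof. exact: prodr_ge0. Qed.

(** Replacing one entry of an independent sample by a fresh one preserves the mean:
swapping the old entry with the new one is a weight-preserving involution. *)
Lemma resample_mean s (j : 'I_s) (h : {ffun 'I_s -> G} -> R) :
  \sum_c prob c * h c = \sum_c prob c * \sum_g mu g * h (resample c j g).
Proof.
transitivity (\sum_(p : {ffun 'I_s -> G} * G) prob p.1 * mu p.2 * h p.1).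
  rewrite -(pair_bigA _ (fun c g => prob c * mu g * h c)) /=; apply: eq_bigr => c _.
  by rewrite -mulr_suml -mulr_sumr mu1 mulr1.
pose f (p : {ffun 'I_s -> G} * G) := (resample p.1 j p.2, p.1 j).
have fK : involutive f.
  move=> [c g]; rewrite /f /= ffunE eqxx; congr pair; apply/ffunP => k.
  by rewrite !ffunE; case: eqP => // ->.
rewrite (reindex_inj (inv_inj fK)) /=.
under [RHS]eq_bigr do rewrite mulr_sumr.
rewrite pair_bigA /=; apply: eq_bigr => -[c g] _ /=; rewrite mulrA; congr (_ * _).
rewrite /prob (bigD1 j)//= ffunE eqxx [X in _ = X * _](bigD1 j)//=.
rewrite (eq_bigr (fun k => mu (c k))); last by move=> k /negbTE kj; rewrite ffunE kj.
by ring.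
Qed.

Variable A : {set I}.

Definition class_card s (c : 'I_s -> G) U := #|[set x in A | trace c x == U]|.

(** The points of [A] fall into classes according to their trace on the sample; an edge
of the cube joins two classes and weighs as much as the smaller one. *)
Definition split_weight s (c : 'I_s -> G) (j : 'I_s) :=
  (\sum_(U : {set 'I_s} | j \notin U)
     minn (class_card c U) (class_card c (j |: U)))%N.

Lemma sum_class_card s (c : 'I_s -> G) : (\sum_U class_card c U = #|A|)%N.
Proof.
rewrite -sum1_card (partition_big (trace c) xpredT)//=; apply: eq_bigr => U _.
by rewrite sum1_card; apply: eq_card => x; rewrite !inE.
Qed.

Lemma class_card_le s (c : 'I_s -> G) U : (class_card c U <= #|A|)%N.
Proof. by apply: subset_leq_card; apply/subsetP => x; rewrite inE => /andP[]. Qed.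

Lemma minn_layers (n a b : nat) : (a <= n)%N -> (b <= n)%N ->
  minn a b = (\sum_(t < n) ((t < a) && (t < b)))%N.
Proof.
move=> an bn; under eq_bigr do rewrite -leq_min.
have count (p m : nat) : (\sum_(t < p) (t < m) = minn m p)%N.
  elim: p => [|p IHp]; first by rewrite big_ord0 minn0.
  by rewrite big_ord_recr /= IHp; case: (ltnP p m) => pm /=; lia.
by rewrite count; symmetry; apply/minn_idPl; rewrite geq_min an.
Qed.

(** Layer by layer, the classes with more than [t] points form a set system of dimension
at most [d], which has at most [d] times as many edges as members. Summing over
[t] turns the members into the points of [A]. *)
Lemma split_weight_le s (c : 'I_s -> G) : dual_vc_le ->
  (\sum_j split_weight c j <= d * #|A|)%N.
Proof.
move=> vc.
pose F t := [set U | (t < class_card c U)%N].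
have vF t : vc_le (F t) d.
  apply: vc_le_sub (vc s c); apply/subsetP => U; rewrite inE => h.
  have : (0 < class_card c U)%N by apply: leq_ltn_trans h.
  by case/card_gt0P => x; rewrite inE => /andP[_ /eqP <-]; rewrite imset_f.
have eF t : (#|cube_edges (F t)| <= d * #|F t|)%N.
  by have [] := sauer_shelah_haussler (A := setT) (fun U _ => subsetT U) (vF t).
have -> : (\sum_j split_weight c j = \sum_(t < #|A|) #|cube_edges (F t)|)%N.
  transitivity (\sum_(U : {set 'I_s}) \sum_j \sum_(t < #|A|) ((U, j) \in cube_edges (F t)))%N; last first.
    under [RHS]eq_bigr do rewrite -sum1_card big_mkcond/=.
    rewrite pair_bigA [RHS]exchange_big; apply: eq_bigr => -[U j] _.
    by apply: eq_bigr => t _; case: (_ \in _).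
  rewrite [RHS]exchange_big; apply: eq_bigr => j _.
  rewrite /split_weight big_mkcond/=; apply: eq_bigr => U _; case: ifPn => jU.
    rewrite (minn_layers (class_card_le _ _) (class_card_le _ _)).
    by apply: eq_bigr => t _; rewrite !inE /= jU /=; case: andP.
  by rewrite big1// => t _; rewrite !inE /= (negbTE jU) andbF.
apply: (@leq_trans (\sum_(t < #|A|) d * #|F t|)); first by apply: leq_sum => t _; exact: eF.
rewrite -big_distrr leq_mul2l /= -(sum_class_card c).
apply/orP; right.
under eq_bigr do rewrite -sum1_card big_mkcond/=.
rewrite exchange_big /= leq_sum// => U _.
rewrite -[leqRHS]minnn (minn_layers (class_card_le c U) (class_card_le c U)).
by rewrite sum_class_card; apply: leq_sum => t _; rewrite inE andbb; case: ifP.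
Qed.

Variable delta : R.
Hypothesis delta_ge0 : 0 <= delta.
Hypothesis separated : forall x y, x \in A -> y \in A -> x != y -> delta <= sep_weight x y.

Let block s (c : 'I_s -> G) j (U : {set 'I_s}) := [set x in A | trace c x :\ j == U].

Lemma class_card_resample s (c : {ffun 'I_s -> G}) j g (U : {set 'I_s}) : j \notin U ->
  class_card (resample c j g) U = #|[set x in block c j U | ~~ M g x]| /\
  class_card (resample c j g) (j |: U) = #|[set x in block c j U | M g x]|.
Proof.
move=> jU.
have tr x : trace (resample c j g) x = if M g x then j |: (trace c x :\ j) else trace c x :\ j.
  apply/setP => k; case: ifP => Mg; rewrite !inE !ffunE; case: eqP => //= ->.
split; apply: eq_card => x; rewrite !inE tr; case: ifP => Mg; rewrite ?andbT ?andbF//.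
- by apply/negbTE/nandP; right; apply: contra jU => /eqP <-; rewrite setU11.
- congr (_ && _); apply/eqP/eqP => [|->//] h.
  by rewrite -(setU1K jU) -h setU1K// !inE eqxx.
- apply/negbTE/nandP; right; apply/eqP => h.
  by have := setU11 j U; rewrite -h !inE eqxx.
Qed.

Lemma pairs_split (B : {set I}) (p : pred I) :
  (\sum_(x in B) \sum_(y in B) (p x != p y) =
   2 * (#|[set x in B | p x]| * #|[set x in B | ~~ p x]|))%N.
Proof.
pose P := [set x in B | p x]; pose N := [set x in B | ~~ p x].
rewrite (bigID p)/= mul2n -addnn; congr (_ + _)%N.
  rewrite (eq_bigr (fun=> #|N|)); last first.
    move=> x /andP[_ px]; rewrite px -sum1_card big_mkcond [RHS]big_mkcond /=.
    by apply: eq_bigr => y _; rewrite !inE; case: (y \in B); case: (p y).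
  by rewrite sum_nat_const; congr (_ * _)%N; apply: eq_card => x; rewrite !inE.
rewrite (eq_bigr (fun=> #|P|)); last first.
  move=> x /andP[_ /negbTE px]; rewrite px -sum1_card big_mkcond [RHS]big_mkcond /=.
  by apply: eq_bigr => y _; rewrite !inE; case: (y \in B); case: (p y).
by rewrite sum_nat_const mulnC; congr (_ * _)%N; apply: eq_card => x; rewrite !inE.
Qed.

(** A random range separates a given pair of points of [B] with probability at least
[delta], so it cuts many pairs; and if it cuts [B] into parts of sizes p and q, then
p q is at most #|B| times the smaller part. *)
Lemma mean_min_split (B : {set I}) : B \subset A ->
  delta / 2 * (#|B|%:R - (B != set0)%:R) <=
  \sum_g mu g * (minn #|[set x in B | ~~ M g x]| #|[set x in B | M g x]|)%:R.
Proof.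
move=> BA; have [->|B0] := eqVneq B set0.
  by rewrite cards0 subrr mulr0; apply: sumr_ge0 => g _; rewrite mulr_ge0.
have b0 : 0 < #|B|%:R :> R by rewrite ltr0n card_gt0.
rewrite -(ler_pM2l b0) mulr_sumr.
have pairs : \sum_g mu g * (\sum_(x in B) \sum_(y in B) (M g x != M g y))%:R =
    \sum_(x in B) \sum_(y in B) sep_weight x y.
  under eq_bigr do rewrite natr_sum mulr_sumr.
  rewrite exchange_big /=; apply: eq_bigr => x _.
  under eq_bigr do rewrite natr_sum mulr_sumr.
  rewrite exchange_big /=; apply: eq_bigr => y _.
  rewrite /sep_weight [RHS]big_mkcond /=; apply: eq_bigr => g _.
  by case: (M g x != M g y); rewrite ?mulr1 ?mulr0.
apply: (@le_trans _ _ (\sum_g mu g * (#|[set x in B | M g x]| * #|[set x in B | ~~ M g x]|)%:R)).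
  have -> : \sum_g mu g * (#|[set x in B | M g x]| * #|[set x in B | ~~ M g x]|)%:R
      = 2^-1 * \sum_(x in B) \sum_(y in B) sep_weight x y.
    rewrite -pairs mulr_sumr; apply: eq_bigr => g _.
    by rewrite pairs_split natrM; field.
  rewrite [leLHS](_ : _ = 2^-1 * (#|B|%:R * (#|B|%:R - 1) * delta)); last by rewrite /=; field.
  apply: ler_wpM2l; first by rewrite invr_ge0.
  have -> : #|B|%:R * (#|B|%:R - 1) * delta = \sum_(x in B) (#|B|%:R - 1) * delta.
    by rewrite sumr_const -(mulr_natl (_ * _)) mulrA.
  apply: ler_sum => x xB.
  have -> : (#|B|%:R - 1) * delta = \sum_(y in B :\ x) delta.
    rewrite sumr_const -[RHS]mulr_natl; congr (_ * _).
    by rewrite (cardsD1 x B) xB natrD /= addrC addKr.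
  rewrite (bigD1 x xB)/= ler_wpDl//; first by apply: sumr_ge0.
  rewrite (eq_bigl (fun y => (y \in B) && (y != x))); last by move=> y; rewrite !inE andbC.
  apply: ler_sum => y /andP[yB yx]; apply: separated; rewrite 1?eq_sym//.
    exact: (subsetP BA).
  exact: (subsetP BA).
apply: ler_sum => g _; rewrite mulrCA; apply: ler_wpM2l => //.
rewrite -natrM ler_nat.
have -> : #|B| = (#|[set x in B | M g x]| + #|[set x in B | ~~ M g x]|)%N.
  rewrite -(cardsID [set x | M g x] B); congr (_ + _)%N.
    by apply: eq_card => x; rewrite !inE.
  by apply: eq_card => x; rewrite !inE andbC.
move: (#|_|) (#|_|) => p q; case: (leqP q p) => qp.
  by rewrite mulnDl [(p * q)%N]mulnC leq_addl.
by rewrite mulnDl leq_addr.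
Qed.

(** The sample without its entry [j] defines at most [s.+1 ^ d] classes, and
[mean_min_split] applies to each of them. *)
Lemma mean_split_weight s (c : {ffun 'I_s -> G}) j : dual_vc_le ->
  delta / 2 * (#|A|%:R - (s.+1 ^ d)%:R) <=
  \sum_g mu g * (split_weight (resample c j g) j)%:R.
Proof.
move=> vc.
have -> : \sum_g mu g * (split_weight (resample c j g) j)%:R =
  \sum_(U : {set 'I_s} | j \notin U) \sum_g mu g * (minn #|[set x in block c j U | ~~ M g x]|
     #|[set x in block c j U | M g x]|)%:R.
  rewrite exchange_big /=; apply: eq_bigr => g _; rewrite -mulr_sumr -natr_sum.
  congr (_ * _%:R); apply: eq_bigr => U jU.
  by have [-> ->] := class_card_resample c g jU.
apply: (@le_trans _ _ (\sum_(U : {set 'I_s} | j \notin U)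
   delta / 2 * (#|block c j U|%:R - (block c j U != set0)%:R))); last first.
  apply: ler_sum => U jU; apply: mean_min_split.
  by apply/subsetP => x; rewrite inE => /andP[].
rewrite -mulr_sumr; apply: ler_wpM2l; first by rewrite divr_ge0.
rewrite sumrB -!natr_sum; apply: lerB.
  rewrite ler_nat -sum1_card (partition_big (fun x => trace c x :\ j) (fun U : {set 'I_s} => j \notin U))/=; last first.
    by move=> x _; rewrite !inE eqxx.
  apply: leq_sum => U _; rewrite -sum1_card; apply: eq_leq; apply: eq_bigl => x.
  by rewrite !inE.
rewrite ler_nat.
have [cF _] := sauer_shelah_haussler (A := setT) (fun U _ => subsetT U) (vc s c).
rewrite cardsT card_ord in cF.
apply: leq_trans (leq_trans (leq_imset_card (fun U : {set 'I_s} => U :\ j) _) cF).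
rewrite -sum1_card big_mkcond [leqRHS]big_mkcond/=; apply: leq_sum => U _.
case: ifP => // jU; case: eqVneq => //= /set0Pn[x]; rewrite inE => /andP[_ /eqP <-].
by rewrite (imset_f (fun U : {set 'I_s} => U :\ j)) ?imset_f.
Qed.

(** The mean total weight of the edges of the cube is bounded above by [split_weight_le]
and below by [mean_split_weight], once for each of the [s] directions. *)
Lemma haussler_packing s : dual_vc_le -> (2 * s.+1 ^ d <= #|A|)%N ->
  s%:R * delta <= 4 * d%:R.
Proof.
move=> vc nA.
have lo : s%:R * (delta / 2 * (#|A|%:R - (s.+1 ^ d)%:R)) <=
    \sum_c prob c * (\sum_(j < s) split_weight c j)%:R.
  under eq_bigr do rewrite natr_sum mulr_sumr.
  rewrite exchange_big /=.
  have -> (u : R) : s%:R * u = \sum_(j < s) u by rewrite sumr_const card_ord mulr_natl.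
  apply: ler_sum => j _; rewrite (resample_mean j).
  rewrite -[leLHS]mul1r -[X in X * _ <= _](prob_sum1 s) mulr_suml; apply: ler_sum => c _.
  apply: ler_wpM2l; first exact: prob_ge0.
  exact: mean_split_weight.
have up : \sum_c @prob s c * (\sum_(j < s) split_weight c j)%:R <= d%:R * #|A|%:R.
  rewrite -[leRHS]mul1r -[X in _ <= X * _](prob_sum1 s) mulr_suml; apply: ler_sum => c _.
  apply: ler_wpM2l; first exact: prob_ge0.
  by rewrite -natrM ler_nat; exact: split_weight_le.
have n0 : 0 < #|A|%:R :> R.
  by rewrite ltr0n; apply: leq_trans nA; rewrite muln_gt0 expn_gt0.
have hn : 2 * (s.+1 ^ d)%:R <= #|A|%:R :> R by rewrite -natrM ler_nat.
have := le_trans lo up.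
set S := (s.+1 ^ d)%:R in hn *; move: (s%:R) (#|A|%:R) (d%:R) (ler0n R s) n0 hn.
move=> a n e a0 n0 hn h.
have : 0 <= a * delta by rewrite mulr_ge0.
have : a * delta * (n / 4) <= a * (delta / 2 * (n - S)).
  rewrite -mulrA [leRHS](_ : _ = a * delta * ((n - S) / 2)); last by field.
  rewrite mulrA ler_wpM2l ?mulr_ge0//; lra.
move=> h1 _; rewrite -(ler_pM2r n0) (_ : a * delta * n = 4 * (a * delta * (n / 4))); last by field.
by rewrite -[leRHS]mulrA ler_pM2l//; exact: le_trans h1 h.
Qed.

End Weights.
End Packing.

(** * Groups of points that few ranges separate *)

Section Clusters.
Import mathcomp.boot.fintype mathcomp.boot.finset.
Variables (R : realType) (I G : finType) (M : G -> I -> bool) (d : nat).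
Hypothesis vcM : dual_vc_le M d.
Implicit Types (A : {set I}) (g : G) (x y : I) (B : seq I).

Definition crosses (S : I -> bool) B := has (fun x => has (fun y => S x != S y) B) B.

Lemma sep_weight_sym (mu : G -> R) x y : sep_weight M mu x y = sep_weight M mu y x.
Proof. by apply: eq_bigl => g; rewrite eq_sym. Qed.

(** A maximal separated subset of [A] has fewer than [k] points by [haussler_packing],
and every point of [A] is close to one of them; by the pigeonhole principle some
centre has [r] close points, and a range crossing these separates one of them from
the centre. *)
Lemma cluster_exists (mu : G -> R) A (r k s : nat) :
  (forall g, 0 <= mu g) -> 0 < \sum_g mu g ->
  (0 < r)%N -> (0 < s)%N -> (2 * s.+1 ^ d <= k)%N -> (r * k <= #|A|)%N ->
  exists B, [/\ uniq B, size B = r, {subset B <= A} &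
    s%:R * \sum_(g | crosses (M g) B) mu g <= (4 * d%:R + 1) * r%:R * \sum_g mu g].
Proof.
move=> mu0 W0 r0 s0 sk kA; set W := \sum_g mu g in W0 *.
pose nu g := mu g / W.
have nu0 g : 0 <= nu g by rewrite divr_ge0// ltW.
have nu1 : \sum_g nu g = 1 by rewrite -mulr_suml divff// gt_eqF.
have sR : 0 < s%:R :> R by rewrite ltr0n.
(* Just above the separation 4 d / s that packing allows. *)
pose delta : R := (4 * d%:R + 1) / s%:R.
have delta0 : 0 < delta by rewrite divr_gt0// ltr_wpDl// mulr_ge0.
pose sep A := [forall x in A, forall y in A, (x != y) ==> (delta <= sep_weight M nu x y)].
have sep0 : sep set0 && (set0 \subset A).
  by rewrite sub0set andbT; apply/forall_inP => x; rewrite inE.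
have [M0 /maxsetP[/andP[sepM M0A] maxM] _] := maxset_exists (P := fun A' => sep A' && (A' \subset A)) sep0.
have small : (#|M0| < k)%N.
  rewrite ltnNge; apply/negP => h.
  have := haussler_packing nu0 nu1 (ltW delta0) _ vcM (leq_trans sk h).
  have -> : s%:R * delta = 4 * d%:R + 1 by rewrite mulrC divfK// gt_eqF.
  have hs : forall x y, x \in M0 -> y \in M0 -> x != y -> delta <= sep_weight M nu x y.
    by move=> x y xM yM xy; have /forall_inP/(_ x xM)/forall_inP/(_ y yM)/implyP := sepM; apply.
  by move=> /(_ hs); lra.
have center x : exists c, x \in A -> (c \in M0) && (sep_weight M nu x c < delta).
  case: (boolP (x \in A)) => xA; last by exists x.
  apply: contrapT => /forallNP noc.
  have far c : c \in M0 -> delta <= sep_weight M nu x c.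
    by move=> cM; rewrite leNgt; apply/negP => h; apply: (noc c) => _; rewrite cM.
  have sx : sep_weight M nu x x = 0.
    by apply: big1 => g; rewrite eqxx.
  have xM : x \in M0.
    rewrite -(maxM (x |: M0)) ?setU11 ?subsetUr//.
    rewrite subUset sub1set xA M0A !andbT; apply/forall_inP => y; rewrite !inE => yM.
    apply/forall_inP => z; rewrite !inE => zM; apply/implyP => yz.
    case/orP: yM yz => [/eqP ->|yM]; case/orP: zM => [/eqP ->|zM].
    - by rewrite eqxx.
    - by move=> _; exact: far.
    - by move=> _; rewrite sep_weight_sym; exact: far.
    - by move=> yz; have /forall_inP/(_ y yM)/forall_inP/(_ z zM)/implyP := sepM; apply.
  by have := far x xM; rewrite sx leNgt delta0.
have {center} [f fP] := choice center.
have [c cM0 big] : exists2 c, c \in M0 & (r <= #|[set x in A | f x == c]|)%N.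
  apply: contrapT => /forall2NP h.
  suff : (#|A| <= r * #|M0|)%N.
    apply/negP; rewrite -ltnNge; apply: leq_trans kA.
    by rewrite ltn_pmul2l.
  rewrite -sum1_card (partition_big f (mem M0))/=; last by move=> x /fP/andP[].
  rewrite mulnC -sum_nat_const; apply: leq_sum => c cM.
  case: (h c) => // /negP; rewrite -ltnNge => /ltnW; apply: leq_trans.
  by rewrite -sum1_card; apply: eq_leq; apply: eq_bigl => x; rewrite inE.
pose B := take r (enum [set x in A | f x == c]).
have BP x : x \in B -> x \in A /\ sep_weight M nu x c < delta.
  move=> /mem_take; rewrite mem_enum inE => /andP[xA /eqP fx]; split=> //.
  by have /andP[_] := fP x xA; rewrite fx.
have sB : size B = r by rewrite size_takel// -cardE.
exists B; split=> //; first by rewrite take_uniq// enum_uniq.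
  by move=> x /BP[].
have step : \sum_(g | crosses (M g) B) nu g <= r%:R * delta.
  apply: (@le_trans _ _ (\sum_(x <- B) sep_weight M nu x c)); last first.
    rewrite -sB -[size B]sum1_size natr_sum mulr_suml !big_seq.
    by apply: ler_sum => x /BP[_ /ltW]; rewrite mul1r.
  rewrite /sep_weight; under [leRHS]eq_bigr do rewrite big_mkcond/=.
  rewrite exchange_big /= [leLHS]big_mkcond/=; apply: ler_sum => g _.
  case: ifP => [|_]; last by apply: sumr_ge0 => x _; case: ifP.
  move=> /hasP[x xB /hasP[y yB xy]].
  have [z zB zc] : exists2 z, z \in B & M g z != M g c.
    case: (eqVneq (M g x) (M g c)) => [e|]; last by exists x.
    by exists y => //; rewrite -e eq_sym.
  rewrite (big_rem z zB)/= zc lerDl; apply: sumr_ge0 => w _; by case: ifP.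
have -> : \sum_(g | crosses (M g) B) mu g = W * \sum_(g | crosses (M g) B) nu g.
  by rewrite mulr_sumr; apply: eq_bigr => g _; rewrite /nu mulrC divfK// gt_eqF.
rewrite [leRHS](_ : _ = s%:R * (W * (r%:R * delta))).
  by rewrite !ler_pM2l.
by rewrite /delta; field; rewrite gt_eqF.
Qed.

End Clusters.

Section Roots.
Variables (R : realType) (d : nat).
Hypothesis d2 : (2 <= d)%N.

Definition droot (k : nat) : R := k%:R `^ (d%:R^-1).

Lemma droot_ge0 k : 0 <= droot k. Proof. exact: powR_ge0. Qed.

Lemma droot_gt0 k : (0 < k)%N -> 0 < droot k.
Proof. by move=> k0; rewrite powR_gt0// ltr0n. Qed.

Lemma droot_exp k : droot k ^+ d = k%:R.
Proof.
rewrite /droot -powR_mulrn ?powR_ge0// -powRrM mulVf ?powRr1//.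
by rewrite pnatr_eq0 -lt0n; apply: ltnW.
Qed.

Lemma ler_droot k l : (k <= l)%N -> droot k <= droot l.
Proof.
move=> kl; apply: ge0_ler_powR; rewrite ?invr_ge0 ?nnegrE ?ler_nat//.
Qed.

(** Stands in for the integral of x^(-1/d). With y^d = z^d + 1 the induction step reduces
to 2 y z^(d-1) <= y^d + z^d, which follows from (y - z)^2 >= 0 and z <= y. *)
Lemma sum_inv_droot k : \sum_(i < k) (droot i.+1)^-1 <= 2 * droot k ^+ d.-1.
Proof.
elim: k => [|k IH].
  by rewrite big_ord0 mulr_ge0// exprn_ge0// droot_ge0.
rewrite big_ord_recr /=; apply: le_trans (lerD IH (lexx _)) _.
rewrite -lerBrDl.
have y0 := droot_gt0 (ltn0Sn k).
rewrite -(ler_pM2l y0) divff ?gt_eqF//.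
have yz := ler_droot (leqnSn k); have z0 := droot_ge0 k.
have := droot_exp k; have := droot_exp k.+1; rewrite -natr1.
move: (droot k) (droot k.+1) y0 yz z0 => z y y0 zy z0.
move=> hy hz; have {hz hy} : 1 = y ^+ d - z ^+ d by rewrite hy hz; ring.
case: d d2 => // -[//|e] _ /=.
have ze : 0 <= z ^+ e by rewrite exprn_ge0.
have yze : z ^+ e <= y ^+ e by rewrite lerXn2r// nnegrE// ltW.
rewrite !exprS; move: (z ^+ e) (y ^+ e) ze yze => a b a0 ab h.
have h1 : 0 <= (y - z) ^+ 2 * a by rewrite mulr_ge0// sqr_ge0.
have h2 : 0 <= y * y * (b - a) by rewrite !mulr_ge0 ?subr_ge0// ltW.
have -> : y * (2 * (y * b) - 2 * (z * a)) = y * (y * b) - z * (z * a) +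
  ((y - z) ^+ 2 * a + y * y * (b - a)) by ring.
by rewrite -h; lra.
Qed.

End Roots.

Section Grouping.
Import mathcomp.boot.fintype mathcomp.boot.finset.
Variables (R : realType) (I G : finType) (M : G -> I -> bool) (d r : nat).
Hypothesis vcM : dual_vc_le M d.
Hypothesis d2 : (2 <= d)%N.
Hypothesis r0 : (0 < r)%N.
Implicit Types (A : {set I}) (g : G) (x y : I) (B : seq I).

Definition grouping_const : R := 4 * (4 * d%:R + 1) * r%:R + 8.

Lemma grouping_const_ge8 : 8 <= grouping_const.
Proof. by rewrite lerDr !mulr_ge0// addr_ge0// mulr_ge0. Qed.

(** The sample size is about half of the d-th root of [k]; when that root is small the
bound exceeds the total weight. *)
Lemma cluster_exists_root (mu : G -> R) A (k : nat) :
  (forall g, 0 <= mu g) -> (0 < k)%N -> (r * k <= #|A|)%N ->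
  exists B, [/\ uniq B, size B = r, {subset B <= A} &
    \sum_(g | crosses (M g) B) mu g <= grouping_const / droot R d k * \sum_g mu g].
Proof.
move=> mu0 k0 kA; set W := \sum_g mu g.
have y0 : 0 < droot R d k by exact: droot_gt0.
have W0 : 0 <= W by exact: sumr_ge0.
have crW B : \sum_(g | crosses (M g) B) mu g <= W.
  by rewrite /W [leRHS](bigID (fun g => crosses (M g) B))/= lerDl sumr_ge0.
have trivial B : droot R d k <= 8 \/ W = 0 ->
    \sum_(g | crosses (M g) B) mu g <= grouping_const / droot R d k * W.
  case=> [y8|W00]; last by apply: le_trans (crW B) _; rewrite W00 mulr0.
  apply: le_trans (crW B) _; rewrite -[leLHS]mul1r; apply: ler_wpM2r => //.
  rewrite ler_pdivlMr// mul1r; apply: le_trans y8 _; exact: grouping_const_ge8.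
have someB : exists B, [/\ uniq B, size B = r & {subset B <= A}].
  exists (take r (enum A)); split; first by rewrite take_uniq// enum_uniq.
    rewrite size_takel// -cardE; apply: leq_trans kA; exact: leq_pmulr.
  by move=> x /mem_take; rewrite mem_enum.
case: (leP (droot R d k) 8) => y8.
  by have [B [? ? ?]] := someB; exists B; split=> //; apply: trivial; left.
have [W00|Wn0] := eqVneq W 0.
  by have [B [? ? ?]] := someB; exists B; split=> //; apply: trivial; right.
have Wp : 0 < W by rewrite lt_neqAle eq_sym Wn0.
pose y := droot R d k.
(* Chosen so that s.+1 <= y / 2, whence 2 * s.+1 ^ d <= k. *)
pose s := (Num.truncn (y / 2)).-1.
have t1 : (4 <= Num.truncn (y / 2))%N.
  rewrite truncn_ge_nat; last by rewrite divr_ge0// ltW.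
  rewrite ler_pdivlMr//.
  by apply: le_trans (ltW y8); rewrite -natrM ler_nat.
have sE : s.+1 = Num.truncn (y / 2) by rewrite /s prednK//; apply: leq_trans t1.
have s0 : (0 < s)%N by rewrite -ltnS sE; apply: leq_trans t1.
have sle : s.+1%:R <= y / 2.
  by rewrite sE truncn_le divr_ge0// ltW.
have sgt : y / 2 < s.+2%:R by rewrite sE; apply: truncnS_gt.
have sk : (2 * s.+1 ^ d <= k)%N.
  rewrite -(ler_nat R) natrM natrX -(droot_exp R d2 k) -/y.
  have -> : y = 2 * (y / 2) by field.
  rewrite exprMn; apply: ler_pM => //.
    by rewrite -[X in X <= _]expr1 ler_eXn2l// ?ltr1n// ltnW.
  by rewrite lerXn2r// nnegrE// divr_ge0// ltW.
have [B [uB sB BA h]] := cluster_exists vcM mu0 Wp r0 s0 sk kA.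
exists B; split=> //.
have sp : 0 < s%:R :> R by rewrite ltr0n.
have ys : y <= 4 * s%:R.
  have e : s.+2%:R = s%:R + 2 :> R by rewrite -addn2 natrD.
  by move: sgt y8; rewrite e -/y => ? ?; lra.
rewrite -(ler_pM2l sp); apply: le_trans h _.
rewrite -/W mulrA; apply: ler_wpM2r => //.
rewrite mulrA ler_pdivlMr// mulrC.
apply: (@le_trans _ _ (4 * s%:R * ((4 * d%:R + 1) * r%:R))).
  by apply: ler_wpM2r => //; rewrite mulr_ge0// addr_ge0// mulr_ge0.
rewrite (_ : 4 * _ * _ = s%:R * (4 * (4 * d%:R + 1) * r%:R)); last by ring.
by apply: ler_wpM2l => //; rewrite /grouping_const lerDl.
Qed.

(** Multiplicative weights: after a group is chosen, the weight of each range that crosses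
it is doubled, so that ranges crossed often become expensive to cross again. *)
Lemma low_crossing_grouping k A (mu : G -> R) : #|A| = (r * k)%N ->
  (forall g, 0 <= mu g) ->
  exists Bs : seq (seq I), [/\ perm_eq (flatten Bs) (enum A),
    all (fun B => size B == r) Bs &
    \sum_g mu g * 2 ^+ count (crosses (M g)) Bs <=
    (\sum_g mu g) * \prod_(i < k) (1 + grouping_const / droot R d i.+1)].
Proof.
elim: k A mu => [|k IH] A mu cA mu0.
  exists [::]; split=> //=.
    by move: cA; rewrite muln0 => /cards0_eq ->; rewrite enum_set0.
  by rewrite big_ord0 mulr1; under eq_bigr do rewrite mulr1.
have [B [uB sB BA hB]] := cluster_exists_root mu0 (ltn0Sn k) (eq_leq (esym cA)).
pose SB := [set x in B].
have SBA : SB \subset A by apply/subsetP => x; rewrite inE; exact: BA.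
have cSB : #|SB| = r by rewrite cardsE (card_uniqP uB).
have cA' : #|A :\: SB| = (r * k)%N.
  by rewrite cardsD (setIidPr SBA) cA cSB mulnS addKn.
pose mu' g := mu g * 2 ^+ (crosses (M g) B).
have mu'0 g : 0 <= mu' g by rewrite mulr_ge0// exprn_ge0.
have [Bs [pBs aBs hBs]] := IH _ mu' cA' mu'0.
exists (B :: Bs); split=> /=; last first.
- have -> : \sum_g mu g * 2 ^+ (crosses (M g) B + count (crosses (M g)) Bs) =
     \sum_g mu' g * 2 ^+ count (crosses (M g)) Bs.
    by apply: eq_bigr => g _; rewrite exprD mulrA.
  apply: le_trans hBs _; rewrite big_ord_recr /= mulrA mulrAC; apply: ler_wpM2r.
    apply: prodr_ge0 => i _; rewrite addr_ge0// divr_ge0 ?droot_ge0//.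
    by apply: le_trans grouping_const_ge8.
  rewrite mulrDr mulr1 mulrC; apply: le_trans (lerD (lexx _) hB).
  rewrite [X in _ + X]big_mkcond/= -big_split/= le_eqVlt; apply/orP; left; apply/eqP.
  by apply: eq_bigr => g _; rewrite /mu'; case: (crosses _ _); rewrite ?expr1 ?expr0; ring.
- by rewrite sB eqxx.
apply: uniq_perm.
- rewrite cat_uniq uB (perm_uniq pBs) enum_uniq andbT /=.
  apply/hasPn => x; rewrite (perm_mem pBs) mem_enum !inE => /andP[].
  by [].
- exact: enum_uniq.
- move=> x; rewrite mem_cat (perm_mem pBs) !mem_enum !inE.
  by case: (boolP (x \in B)) => //= /BA ->.
Qed.

(** A single term of the sum in [low_crossing_grouping] is at most the whole sum. *)
Lemma low_crossing_bound k A : #|A| = (r * k)%N ->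
  exists Bs : seq (seq I), [/\ perm_eq (flatten Bs) (enum A),
    all (fun B => size B == r) Bs &
    forall g, (count (crosses (M g)) Bs)%:R * ln 2 <=
      ln #|G|%:R + 2 * grouping_const * droot R d k ^+ d.-1].
Proof.
move=> cA.
have [Bs [pBs aBs hBs]] := low_crossing_grouping cA (fun=> ler01).
exists Bs; split=> // g.
have G0 : 0 < #|G|%:R :> R by rewrite ltr0n; apply/card_gt0P; exists g.
have h1 : 2 ^+ count (crosses (M g)) Bs <= #|G|%:R * expR (2 * grouping_const * droot R d k ^+ d.-1).
  apply: (@le_trans _ _ (\sum_g 1 * 2 ^+ count (crosses (M g)) Bs)).
    by rewrite (bigD1 g)//= mul1r lerDl sumr_ge0// => i _; rewrite mulr_ge0// exprn_ge0.
  apply: le_trans hBs _; rewrite sumr_const ler_wpM2l//.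
  apply: (@le_trans _ _ (\prod_(i < k) expR (grouping_const / droot R d i.+1))).
    apply: ler_prod => i _; rewrite expR_ge1Dx andbT addr_ge0// divr_ge0 ?droot_ge0//.
    by apply: le_trans grouping_const_ge8.
  rewrite -expR_sum ler_expR -mulr_sumr -mulrA mulrCA; apply: ler_wpM2l.
    by apply: le_trans grouping_const_ge8.
  exact: sum_inv_droot.
have : ln (2 ^+ count (crosses (M g)) Bs) <= ln (#|G|%:R * expR (2 * grouping_const * droot R d k ^+ d.-1)).
  by rewrite ler_ln// posrE ?exprn_gt0// mulr_gt0// expR_gt0.
by rewrite lnXn// lnM ?posrE ?expR_gt0// expRK -[X in X <= _ -> _]mulr_natl.
Qed.

End Grouping.

(** * Colouring groups by cyclic shifts *)

Section Colouring.
Import mathcomp.boot.fintype mathcomp.boot.finset.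
Variables (R : realType) (I : finType) (r : nat).
Variables (T : finType) (S : T -> I -> bool) (col : T -> 'I_r.+1).
Implicit Types (B : seq I) (t : T) (c : I -> 'I_r.+1).

(** The deficit, scaled by the number of colours, of colour [col t] inside the test set
[S t]: cardinality of the set minus [r.+1] times that of its part of that colour. *)
Definition excess (s : seq I) c t : R :=
  \sum_(x <- s) (S t x)%:R * (1 - r.+1%:R * (c x == col t)%:R).

Definition shift_colour B (v : 'I_r.+1) : I -> 'I_r.+1 :=
  fun x => inord (index x B) + v.

Lemma sum_delta (F : 'I_r.+1 -> R) k : \sum_i F i * (i == k)%:R = F k.
Proof.
rewrite (bigD1 k)//= eqxx mulr1 big1 ?addr0// => i /negbTE ->.
by rewrite mulr0.
Qed.

Lemma excess_shift B x0 v t : uniq B -> size B = r.+1 ->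
  excess B (shift_colour B v) t =
  \sum_(i < r.+1) (S t (nth x0 B i))%:R - r.+1%:R * (S t (nth x0 B (col t - v : 'I_r.+1)%R))%:R.
Proof.
move=> uB sB; rewrite /excess (big_nth x0) sB big_mkord.
rewrite (eq_bigr (fun i : 'I_r.+1 => (S t (nth x0 B i))%:R - r.+1%:R * ((S t (nth x0 B i))%:R * (i == col t - v)%:R))); last first.
  move=> i _; rewrite /shift_colour index_uniq ?sB// inord_val.
  have -> : (i + v == col t) = (i == col t - v).
    by rewrite [RHS]eq_sym subr_eq eq_sym.
  by ring.
rewrite sumrB -mulr_sumr; congr (_ - _ * _).
exact: (sum_delta (fun i : 'I_r.+1 => (S t (nth x0 B i))%:R)).
Qed.

Lemma excess_shift_sum B t : uniq B -> size B = r.+1 ->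
  \sum_v excess B (shift_colour B v) t = 0.
Proof.
move=> uB sB; case: B sB uB => // x0 B' sB uB; set B := x0 :: B' in sB uB *.
under eq_bigr do rewrite (excess_shift x0)//.
rewrite sumrB sumr_const card_ord -mulr_sumr.
rewrite [X in _ - _ * X](reindex_inj (inv_inj (subKr (col t)))).
under [X in _ - _ * X]eq_bigr do rewrite subKr.
by rewrite mulr_natl subrr.
Qed.

Lemma excess_shift_uncrossed B v t : uniq B -> size B = r.+1 -> ~~ crosses (S t) B ->
  excess B (shift_colour B v) t = 0.
Proof.
move=> uB sB; case: B sB uB => // x0 B' sB uB; set B := x0 :: B' in sB uB *.
move=> /hasPn nc; rewrite (excess_shift x0)//.
have same (i : 'I_r.+1) : S t (nth x0 B i) = S t x0.
  have := nc x0 (mem_head _ _) => /hasPn/(_ (nth x0 B i)).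
  by rewrite mem_nth ?sB// negbK => /(_ isT)/eqP <-.
under eq_bigr do rewrite same.
by rewrite [in X in _ - X]same sumr_const card_ord mulr_natl subrr.
Qed.

Lemma excess_shift_le B v t : uniq B -> size B = r.+1 ->
  `|excess B (shift_colour B v) t| <= r.+1%:R.
Proof.
move=> uB sB; case: B sB uB => // x0 B' sB uB; set B := x0 :: B' in sB uB *.
rewrite (excess_shift x0)//.
have h0 : 0 <= \sum_(i < r.+1) (S t (nth x0 B i))%:R :> R by apply: sumr_ge0.
have h1 : \sum_(i < r.+1) (S t (nth x0 B i))%:R <= r.+1%:R :> R.
  apply: (@le_trans _ _ (\sum_(i < r.+1) 1)); last by rewrite sumr_const card_ord.
  by apply: ler_sum => i _; case: (S t _).
have bound (n s : R) (b : bool) : 0 <= s -> s <= n -> `|s - n * b%:R| <= n.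
  by move=> s0 sn; rewrite ler_norml; case: b; rewrite ?mulr1 ?mulr0; apply/andP; split; lra.
exact: bound.
Qed.

Lemma expR_le_quadratic (z : R) : `|z| <= 1 / 2 -> expR z <= 1 + z + 2 * z ^+ 2.
Proof.
move=> z2; have [z0 z1] : - (1 / 2) <= z /\ z <= 1 / 2.
  by move: z2; rewrite ler_norml => /andP[].
have h : 1 - z <= expR (- z) := expR_ge1Dx _.
have p : 0 < 1 - z by lra.
rewrite -[z in X in X <= _]opprK expRN.
apply: (@le_trans _ _ (1 - z)^-1); first by rewrite lef_pV2// posrE ?expR_gt0.
rewrite -div1r ler_pdivrMr//.
have : 0 <= z ^+ 2 * (1 - 2 * z) by rewrite mulr_ge0 ?sqr_ge0//; lra.
have -> : (1 + z + 2 * z ^+ 2) * (1 - z) = 1 + z ^+ 2 * (1 - 2 * z) by ring.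
by rewrite lerDl.
Qed.

Variable theta : R.
Hypothesis theta0 : 0 <= theta.
Hypothesis theta_r : theta * r.+1%:R <= 1 / 2.

Let K : R := 2 * (theta * r.+1%:R) ^+ 2.

(** Over the cyclic shifts the excess has mean zero, and it vanishes on groups that are not
crossed; hence only the quadratic term of the exponential remains. *)
Lemma mean_expR_shift B t : uniq B -> size B = r.+1 ->
  \sum_v expR (theta * excess B (shift_colour B v) t) <=
  r.+1%:R * expR (K *+ crosses (S t) B).
Proof.
move=> uB sB; case: (boolP (crosses (S t) B)) => cr; last first.
  rewrite mulr0n expR0 mulr1 (eq_bigr (fun=> 1)) ?sumr_const ?card_ord//.
  by move=> v _; rewrite excess_shift_uncrossed// mulr0 expR0.
rewrite mulr1n.
apply: (@le_trans _ _ (\sum_(v < r.+1) (1 + theta * excess B (shift_colour B v) t + K))).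
  apply: ler_sum => v _; have ex := excess_shift_le v t uB sB.
  have abs : `|theta * excess B (shift_colour B v) t| <= theta * r.+1%:R.
    by rewrite normrM (ger0_norm theta0); apply: ler_wpM2l.
  apply: le_trans (expR_le_quadratic (le_trans abs theta_r)) _.
  rewrite lerD2l; apply: ler_wpM2l => //.
  rewrite -real_normK ?num_real// lerXn2r// nnegrE ?normr_ge0//.
  exact: mulr_ge0.
rewrite big_split /= big_split /= -mulr_sumr excess_shift_sum// mulr0 addr0.
rewrite !sumr_const card_ord -mulrnDl -[leLHS]mulr_natl; apply: ler_wpM2l => //.
exact: expR_ge1Dx.
Qed.

(** The groups are coloured one after the other. For each of them some shift is at least as
good as the average, for weights that already include the bound to be obtained on
the other groups. *)
Lemma balanced_colouring (Bs : seq (seq I)) (nu : T -> R) :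
  (forall t, 0 <= nu t) -> uniq (flatten Bs) -> all (fun B => size B == r.+1) Bs ->
  exists c, \sum_t nu t * expR (theta * excess (flatten Bs) c t) <=
    \sum_t nu t * expR (K *+ count (crosses (S t)) Bs).
Proof.
elim: Bs nu => [|B Bs IH] nu nu0.
  move=> _ _; exists (fun=> ord0); apply: ler_sum => t _.
  by rewrite /excess big_nil mulr0 mulr0n.
rewrite /= cat_uniq => /and3P[uB dis uBs] /andP[/eqP sB aBs].
pose w t := nu t * expR (K *+ count (crosses (S t)) Bs).
have w0 t : 0 <= w t by rewrite mulr_ge0// expR_ge0.
have [v vP] : exists v, \sum_t w t * expR (theta * excess B (shift_colour B v) t) <=
    \sum_t w t * expR (K *+ crosses (S t) B).
  apply: contrapT => /forallNP h.
  have : \sum_(v < r.+1) \sum_t w t * expR (K *+ crosses (S t) B) <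
     \sum_v \sum_t w t * expR (theta * excess B (shift_colour B v) t).
    apply: ltr_sum => [|v _]; first by apply/hasP; exists ord0; rewrite ?mem_index_enum.
    by rewrite ltNge; apply/negP/h.
  apply/negP; rewrite -leNgt exchange_big /= sumr_const card_ord -mulr_natl mulr_sumr.
  apply: ler_sum => t _; rewrite -mulr_sumr mulrCA; apply: ler_wpM2l => //.
  exact: mean_expR_shift.
have [|//|//|c cP] := IH (fun t => nu t * expR (theta * excess B (shift_colour B v) t)).
  by move=> t; rewrite mulr_ge0// expR_ge0.
pose c' x := if x \in B then shift_colour B v x else c x.
have cB t : excess B c' t = excess B (shift_colour B v) t.
  rewrite /excess big_seq [RHS]big_seq; apply: eq_bigr => x xB.
  by rewrite /c' xB.
have cBs t : excess (flatten Bs) c' t = excess (flatten Bs) c t.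
  rewrite /excess big_seq [RHS]big_seq; apply: eq_bigr => x xB.
  by have /hasPn/(_ x xB)/negbTE h := dis; rewrite /c' h.
have exc t : excess (B ++ flatten Bs) c' t =
    excess B (shift_colour B v) t + excess (flatten Bs) c t.
  by rewrite -cB -cBs /excess big_cat.
exists c'; under eq_bigr do rewrite exc mulrDr expRD mulrA.
apply: le_trans cP _.
rewrite (eq_bigr (fun t => w t * expR (theta * excess B (shift_colour B v) t))); last first.
  by move=> t _; rewrite /w mulrAC.
apply: le_trans vP _; apply: ler_sum => t _.
by rewrite /w -mulrA -expRD -mulrnDr addnC.
Qed.

End Colouring.

(** * Half-spaces *)

Section HalfSpaces.
Import mathcomp.boot.fintype mathcomp.boot.finset.
Variable R : realType.

Lemma linear_dependence (K : finType) n (v : K -> 'rV[R]_n) (S : {set K}) :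
  (n < #|S|)%N ->
  exists c : K -> R, (exists2 k, k \in S & c k != 0%R) /\
    \sum_(k in S) c k *: v k = 0.
Proof.
move=> nS.
have [k0 k0S] : exists k, k \in S by apply/card_gt0P; apply: leq_ltn_trans nS.
pose A := \matrix_(i < #|S|) v (enum_val i).
have ker0 : kermx A != 0.
  rewrite kermx_eq0 /row_free; apply/negP => /eqP rA.
  by have := rank_leq_col A; rewrite rA leqNgt nS.
have [i0 wn0] : exists i, row i (kermx A) != 0.
  apply: contrapT => /forallNP h; move: ker0; apply/negP; rewrite negbK; apply/eqP.
  by apply/row_matrixP => i; rewrite row0; apply/eqP; have /negP := h i; rewrite negbK.
pose w := row i0 (kermx A).
have wA : w *m A = 0 by rewrite /w -row_mul mulmx_ker row0.
exists (fun k => w 0 (enum_rank_in k0S k)); split; last first.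
  rewrite big_enum_val/= -[RHS]wA mulmx_sum_row; apply: eq_bigr => i _.
  by rewrite enum_valK_in rowK.
have [j wj] : exists j, w 0 j != 0.
  apply: contrapT => /forallNP h; move: wn0; apply/negP; rewrite negbK; apply/eqP.
  by apply/rowP => j; rewrite [RHS]mxE; apply/eqP; have /negP := h j; rewrite negbK.
by exists (enum_val j); [exact: enum_valP|rewrite enum_valK_in].
Qed.

Variables (I : finType) (d : nat) (z : I -> 'rV[R]_d.+1) (h : 'rV[R]_d.+1).
Hypothesis hz : forall i, dot h (z i) = 1.

Definition halfspace_traces : {set {set I}} :=
  [set S | `[<exists u : 'rV[R]_d.+1, S = [set i | 0 < dot u (z i)]>]].

Definition halfspace := {S : {set I} | S \in halfspace_traces}.

Definition in_halfspace (g : halfspace) (i : I) := i \in val g.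

Lemma halfspace_vec (g : halfspace) :
  exists u, forall i, in_halfspace g i = (0 < dot u (z i)).
Proof.
case: g => S SG.
have /asboolP[u uS] : `[<exists u : 'rV[R]_d.+1, S = [set i | 0 < dot u (z i)]>].
  by have := SG; rewrite {1}inE.
by exists u => i; rewrite /in_halfspace /= uS inE.
Qed.

Lemma halfspace_of_vec u : exists g, forall i, in_halfspace g i = (0 < dot u (z i)).
Proof.
have uG : [set i | 0 < dot u (z i)] \in halfspace_traces.
  by rewrite inE; apply/asboolP; exists u.
by exists (exist (fun S : {set I} => S \in halfspace_traces) _ uG) => i; rewrite /in_halfspace /= inE.
Qed.

Lemma dotZl n c (x u : 'rV[R]_n) : dot (c *: x) u = c * dot x u.
Proof. by rewrite !(dotC _ u) dotZr. Qed.

Lemma dot_suml n (K : Type) (s : seq K) (P : pred K) (f : K -> 'rV[R]_n) u :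
  dot (\sum_(k <- s | P k) f k) u = \sum_(k <- s | P k) dot (f k) u.
Proof. by rewrite dotC dot_sumr; apply: eq_bigr => k _; rewrite dotC. Qed.

(** Among [d.+2] vectors there is a linear relation, and a half-space containing exactly the
vectors with positive coefficient contradicts it, or its negative. *)
Lemma card_halfspace : (#|{: halfspace}| <= #|I|.+1 ^ d.+1)%N.
Proof.
have vcG : vc_le halfspace_traces d.+1; last first.
  have [c _] := sauer_shelah_haussler (A := setT) (fun U _ => subsetT U) vcG.
  by rewrite cardsT in c; apply: leq_trans c; rewrite card_sig; apply: eq_leq; apply: eq_card.
move=> S sh; rewrite leqNgt; apply/negP => /(linear_dependence z)[c [[k kS ck] dep]].
have key (e : I -> R) : \sum_(i in S) e i *: z i = 0 -> forall i, i \in S -> e i <= 0.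
  move=> e0 i iS; rewrite leNgt; apply/negP => ei.
  have TS : [set i in S | 0 < e i] \subset S by apply/subsetP => x; rewrite inE => /andP[].
  have [U] := sh _ TS; rewrite inE => /asboolP[u ->] ueq.
  have pos x : x \in S -> (0 < dot u (z x)) = (0 < e x).
    by move=> xS; have /setP/(_ x) := ueq; rewrite !inE xS andbT.
  have : dot u (\sum_(i in S) e i *: z i) = 0 by rewrite e0 dot0r.
  apply/eqP; rewrite gt_eqF// dot_sumr (bigD1 i)//= dotZr ltr_pwDl//.
    by rewrite mulr_gt0// pos.
  apply: sumr_ge0 => x /andP[xS _]; rewrite dotZr.
  case: (ltP 0 (e x)) => ex; first by rewrite mulr_ge0// ltW// pos.
  by apply: mulr_le0 => //; rewrite leNgt pos// -leNgt.
have c1 := key _ dep k kS.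
have c2 : - c k <= 0.
  apply: (key (fun i => - c i)) => //.
  by under eq_bigr do rewrite scaleNr; rewrite sumrN dep oppr0.
by move: ck; rewrite eq_le c1 -oppr_le0 c2.
Qed.

(** Restricted to the affine chart, [d.+1] linear forms and the constant 1 satisfy a linear
relation. A point at which exactly the forms with positive coefficient are positive
contradicts the relation or its negative. *)
Lemma halfspace_dual_vc : dual_vc_le in_halfspace d.
Proof.
move=> s c S sh; rewrite leqNgt; apply/negP => dS.
have [u shu] : exists u : 'I_s -> 'rV[R]_d.+1, forall T : {set 'I_s}, T \subset S ->
    exists x, forall k, k \in S -> (0 < dot (u k) (z x)) = (k \in T).
  have /choice[u uP] : forall k, exists u, forall i,
      in_halfspace (c k) i = (0 < dot u (z i)) by move=> k; exact: (halfspace_vec (c k)).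
  exists u => T TS; have [U /imsetP[x _ ->] xT] := sh T TS.
  by exists x => k kS; rewrite -uP; have /setP/(_ k) := xT; rewrite !inE kS andbT.
pose w (o : option 'I_s) := if o is Some k then u k else h.
pose S' : {set option 'I_s} := None |: Some @: S.
have nS : None \notin Some @: S by apply/imsetP => -[].
have cS : (d.+1 < #|S'|)%N.
  by rewrite cardsU1 nS add1n ltnS card_imset//; exact: Some_inj.
have [e [[q qS eq0] dep]] := linear_dependence w cS.
have {dep} dep x : e None + \sum_(k in S) e (Some k) * dot (u k) (z x) = 0.
  rewrite -[RHS](dot0r (z x)) -dep dotC dot_suml /S' big_setU1//= dotZl hz mulr1.
  rewrite big_imset/=; last by move=> ? ? _ _; exact: Some_inj.
  by congr (_ + _); apply: eq_bigr => k _; rewrite dotZl.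
have key (f : 'I_s -> R) c0 : (forall x, c0 + \sum_(k in S) f k * dot (u k) (z x) = 0) ->
    c0 <= 0 /\ (0 <= c0 -> forall k, k \in S -> f k <= 0).
  move=> H.
  have TS : [set k in S | 0 < f k] \subset S by apply/subsetP => x; rewrite inE => /andP[].
  have [x xP] := shu _ TS.
  have pos k : k \in S -> (0 < dot (u k) (z x)) = (0 < f k).
    by move=> kS; rewrite xP// inE kS.
  have ge0 k : k \in S -> 0 <= f k * dot (u k) (z x).
    move=> kS; case: (ltP 0 (f k)) => fk; first by rewrite mulr_ge0// ltW// pos.
    by apply: mulr_le0 => //; rewrite leNgt pos// -leNgt.
  have sum0 : 0 <= \sum_(k in S) f k * dot (u k) (z x) by apply: sumr_ge0.
  have Hx := H x; split; first by lra.
  move=> c00 k kS; rewrite leNgt; apply/negP => fk.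
  have : 0 < \sum_(k in S) f k * dot (u k) (z x).
    rewrite (bigD1 k)//= ltr_pwDl//; first by rewrite mulr_gt0// pos.
    by apply: sumr_ge0 => l /andP[lS _]; exact: ge0.
  lra.
have [a1 b1] := key (fun k => e (Some k)) (e None) dep.
have depN x : - e None + \sum_(k in S) - e (Some k) * dot (u k) (z x) = 0.
  under eq_bigr do rewrite mulNr.
  by rewrite sumrN -opprD dep oppr0.
have [a2 b2] := key (fun k => - e (Some k)) (- e None) depN.
have e0 : e None = 0 by lra.
rewrite e0 oppr0 lexx in b1 b2.
case: q qS eq0 => [k|] qS; last by rewrite e0 eqxx.
have kS : k \in S.
  by move: qS; rewrite !inE /= => /imsetP[l lS [->]].
have := b1 isT k kS; have := b2 isT k kS; rewrite oppr_le0 => h1 h2.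
by rewrite eq_le h1 h2.
Qed.

End HalfSpaces.

Section GenericForm.
Variable R : realType.

(** On the moment curve a nonzero vector vanishes at finitely many parameters only. *)
Lemma nonvanishing_form (I : finType) n (y : I -> 'rV[R]_n) :
  (forall i, y i != 0) -> exists h, forall i, dot h (y i) != 0.
Proof.
move=> y0.
pose P := \prod_i rVpoly (y i).
have Pn0 : P != 0.
  apply/prodf_neq0 => i _; apply: contra (y0 i) => /eqP h.
  by apply/eqP/(can_inj rVpolyK); rewrite h linear0.
have [k Pk] : exists k : nat, P.[k%:R] != 0.
  apply: contrapT => /forallNP h.
  have := max_poly_roots (rs := [seq k%:R | k <- iota 0 (size P)]) Pn0.
  rewrite size_map size_iota ltnn => H.
  suff : false by [].
  apply: H.
    apply/allP => _ /mapP[k _ ->]; apply/rootP/eqP.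
    by have /negP := h k; rewrite negbK.
  by rewrite map_inj_uniq ?iota_uniq//; exact: mulrIn (oner_neq0 _).
exists (\row_j k%:R ^+ j) => i.
have : (rVpoly (y i)).[k%:R] != 0.
  by move: Pk; rewrite /P horner_prod => /prodf_neq0; apply.
rewrite (horner_coef_wide _ (size_poly _ _)); apply: contra => /eqP h0.
apply/eqP; apply: etrans h0; apply: eq_bigr => j _.
by rewrite mxE -[(\poly_(_ < _) _)%R]/(rVpoly (y i)) coef_rVpoly_ord mulrC.
Qed.

End GenericForm.

(** * Discrepancy of the sets of hyperplanes met by a ray *)

Section RayDiscrepancy.
Import mathcomp.boot.fintype mathcomp.boot.finset.
Variables (R : realType) (I : finType) (d r m : nat).
Variables (a : I -> 'rV[R]_d) (b : I -> R).
Hypothesis a_neq0 : forall i, a i != 0.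
Hypothesis d2 : (2 <= d)%N.
Hypothesis cardI : #|I| = (r.+1 * m)%N.

Definition met_by_ray p v : {set I} := [set i | aff a b i p * dot (a i) v <= 0].

Lemma dot_row_mx n1 n2 (x1 y1 : 'rV[R]_n1) (x2 y2 : 'rV[R]_n2) :
  dot (row_mx x1 x2) (row_mx y1 y2) = dot x1 y1 + dot x2 y2.
Proof.
rewrite /dot big_split_ord /=; congr (_ + _); apply: eq_bigr => j _.
  by rewrite !row_mxEl.
by rewrite !row_mxEr.
Qed.

(** A group split by none of the four sets lies on one side of the combined set. *)
Lemma count_crosses_wedge (f1 f2 f3 f4 : I -> bool) (Bs : seq (seq I)) :
  (count (crosses (fun i => ~~ (f1 i && f3 i || f2 i && f4 i))) Bs <=
   count (crosses f1) Bs + count (crosses f2) Bs +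
   count (crosses f3) Bs + count (crosses f4) Bs)%N.
Proof.
set S := fun i => _.
have step B : (crosses S B <= crosses f1 B + crosses f2 B + crosses f3 B + crosses f4 B)%N.
  case cS: (crosses S B) => //.
  case c1: (crosses f1 B) => //; case c2: (crosses f2 B) => //.
  case c3: (crosses f3 B) => //; case c4: (crosses f4 B) => //.
  have same f x y : crosses f B = false -> x \in B -> y \in B -> f x = f y.
    move=> /hasPn nc xB yB; have /hasPn/(_ y yB) := nc x xB.
    by rewrite negbK => /eqP.
  move: cS => /hasP[x xB /hasP[y yB]].
  by rewrite /S (same _ x y c1)// (same _ x y c2)// (same _ x y c3)// (same _ x y c4)// eqxx.
elim: Bs => [|B Bs IH] //=; apply: leq_trans (leq_add (step B) IH) _.
move: (nat_of_bool _) (nat_of_bool _) (nat_of_bool _) (nat_of_bool _) => p1 p2 p3 p4.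
move: (count _ _) (count _ _) (count _ _) (count _ _) => q1 q2 q3 q4.
lia.
Qed.

Lemma mulr_le0_signs (x y : R) :
  ~~ ((0 < x) && (0 < y) || (0 < - x) && (0 < - y)) = (x * y <= 0).
Proof.
rewrite leNgt; congr (~~ _); rewrite !oppr_gt0.
case: (ltrgt0P x) => [hx|hx|->] /=; last by rewrite mul0r ltxx.
  by rewrite orbF pmulr_rgt0.
by rewrite nmulr_rgt0.
Qed.

(** The hyperplane a.x = b becomes the vector (a, -b), normalised by a form that vanishes
at none of these vectors. A ray (p, v) becomes the pair of forms (p, 1) and (v, 0);
rescaling the vector does not change the sign of the product of the two values. *)
Lemma chart : exists z : I -> 'rV[R]_d.+1, (exists h, forall i, dot h (z i) = 1) /\
  forall p v, exists lp lv : 'rV[R]_d.+1, forall i,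
    (aff a b i p * dot (a i) v <= 0) = (dot lp (z i) * dot lv (z i) <= 0).
Proof.
rewrite -(addn1 d).
pose y i : 'rV[R]_(d + 1) := row_mx (a i) (- b i)%:M.
have yn0 i : y i != 0.
  apply: contra (a_neq0 i) => /eqP; rewrite -row_mx0 => /eq_row_mx[-> _].
  by [].
have [h hP] := nonvanishing_form yn0.
exists (fun i => (dot h (y i))^-1 *: y i); split.
  by exists h => i; rewrite dotZr mulVf.
move=> p v; exists (row_mx p 1%:M), (row_mx v 0) => i; rewrite !dotZr.
have d1 (x x' : 'rV[R]_1) : dot x x' = x 0 0 * x' 0 0 by rewrite /dot big_ord1.
have -> : dot (row_mx p 1%:M) (y i) = aff a b i p.
  by rewrite dot_row_mx d1 !mxE eqxx !mulr1n mul1r dotC.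
have -> : dot (row_mx v 0) (y i) = dot (a i) v.
  by rewrite dot_row_mx [X in _ + X]dotC dot0r addr0 dotC.
move: (dot h (y i)) (hP i) => t t0.
have -> (p' q : R) : t^-1 * p' * (t^-1 * q) = (t^-1) ^+ 2 * (p' * q) by ring.
by rewrite [in RHS]pmulr_rle0// exprn_even_gt0//= invr_eq0.
Qed.

Definition crossing_bound : R :=
  (d.+1%:R * ln (#|I|.+1%:R) + 2 * grouping_const R d r.+1 * droot R d m ^+ d.-1) / ln 2.

(** Each set met by a ray is determined by four half-spaces, so the number of tests is
polynomial in [#|I|] and a test crosses at most four times as many groups as a
half-space does. *)
Lemma ray_discrepancy (theta : R) : 0 < theta -> theta * r.+1%:R <= 1 / 2 ->
  exists c : I -> 'I_r.+1, forall p v j,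
    theta * (#|met_by_ray p v|%:R - r.+1%:R * #|[set i in met_by_ray p v | c i == j]|%:R)
    <= ln r.+1%:R + 4 * (d.+1%:R * ln (#|I|.+1%:R)) +
       8 * (theta * r.+1%:R) ^+ 2 * crossing_bound.
Proof.
move=> th0 thr.
have [z [[h hz] zP]] := chart.
pose G := halfspace z; pose M : G -> I -> bool := @in_halfspace R I d z.
have vc : dual_vc_le M d by exact: halfspace_dual_vc hz.
have [Bs [pBs aBs kBs]] := @low_crossing_bound R I G M d r.+1 vc d2 (ltn0Sn r) m setT (etrans (cardsT I) cardI).
have ln2 : 0 < ln 2 :> R by rewrite ln_gt0// ltr1n.
have G0 : (0 < #|{: G}|)%N by have [g _] := halfspace_of_vec z 0; apply/card_gt0P; exists g.
have lnG : ln #|{: G}|%:R <= d.+1%:R * ln (#|I|.+1%:R) :> R.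
  rewrite mulr_natl -lnXn// ler_ln ?posrE ?ltr0n// ?exprn_gt0//.
  by rewrite -natrX ler_nat; exact: card_halfspace.
have kB g : (count (crosses (M g)) Bs)%:R <= crossing_bound.
  rewrite ler_pdivlMr//; apply: le_trans (kBs g) _; rewrite lerD2r.
  exact: lnG.
pose T := (G * G * (G * G) * 'I_r.+1)%type.
pose S (t : T) i := ~~ (M t.1.1.1 i && M t.1.2.1 i || M t.1.1.2 i && M t.1.2.2 i).
pose col (t : T) := t.2.
have uBs : uniq (flatten Bs) by rewrite (perm_uniq pBs) enum_uniq.
have [c cP] := @balanced_colouring R I r T S col theta (ltW th0) thr Bs (fun=> 1) (fun=> ler01) uBs aBs.
exists c => p v j.
have [lp [lv lP]] := zP p v.
have hs u : exists g, forall i, M g i = (0 < dot u (z i)) by exact: halfspace_of_vec.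
have [g1 g1P] := hs lp; have [g2 g2P] := hs (- lp).
have [g3 g3P] := hs lv; have [g4 g4P] := hs (- lv).
have dotN (u w : 'rV[R]_d.+1) : dot (- u) w = - dot u w by rewrite -scaleN1r dotZl mulN1r.
pose t : T := ((g1, g2), (g3, g4), j).
have St i : S t i = (i \in met_by_ray p v).
  rewrite inE lP -mulr_le0_signs -!dotN -g1P -g2P -g3P -g4P.
  by [].
have exE : excess R S col (flatten Bs) c t =
   #|met_by_ray p v|%:R - r.+1%:R * #|[set i in met_by_ray p v | c i == j]|%:R.
  rewrite /excess (perm_big _ pBs) /= -[X in \sum_(i <- X) _]/(enum setT).
  under eq_bigr do rewrite mulrBr mulr1 mulrCA St.
  rewrite sumrB -mulr_sumr; congr (_ - _ * _).
    rewrite big_enum /= -natr_sum; congr _%:R.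
    by rewrite -sum1_card [RHS]big_mkcond /=; apply: eq_big => i; rewrite ?inE//; case: (i \in _).
  rewrite big_enum /= -sum1_card natr_sum [RHS]big_mkcond/=.
  apply: eq_big => i; rewrite ?inE// => _; rewrite /col /=.
  by case: (_ <= 0); case: (_ == _); rewrite ?mulr1 ?mulr0.
rewrite -exE.
have cnt t' : (count (crosses (S t')) Bs)%:R <= 4 * crossing_bound.
  have le4 := @count_crosses_wedge (M t'.1.1.1) (M t'.1.1.2) (M t'.1.2.1) (M t'.1.2.2) Bs.
  apply: (@le_trans _ _ (crossing_bound + crossing_bound + crossing_bound + crossing_bound)).
    by apply: le_trans (_ : _ <= (_ + _ + _ + _)%:R) _; [rewrite ler_nat; exact: le4|rewrite !natrD !lerD].
  lra.
have T0 : 0 < #|{: T}|%:R :> R.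
  by rewrite ltr0n; apply/card_gt0P; exists t.
pose K : R := 2 * (theta * r.+1%:R) ^+ 2.
have K0 : 0 <= K by rewrite mulr_ge0// sqr_ge0.
have main : expR (theta * excess R S col (flatten Bs) c t) <= #|{: T}|%:R * expR (K * (4 * crossing_bound)).
  apply: (@le_trans _ _ (\sum_t 1 * expR (theta * excess R S col (flatten Bs) c t))).
    by rewrite (bigD1 t)//= mul1r lerDl sumr_ge0// => i _; rewrite mul1r expR_ge0.
  apply: le_trans cP _.
  apply: (@le_trans _ _ (\sum_(t' : T) expR (K * (4 * crossing_bound)))).
    apply: ler_sum => t' _.
    by rewrite mul1r ler_expR -/K -[K *+ _]mulr_natr; apply: ler_wpM2l.
  by rewrite sumr_const -[leLHS]mulr_natl.
have : ln (expR (theta * excess R S col (flatten Bs) c t)) <= ln (#|{: T}|%:R * expR (K * (4 * crossing_bound))).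
  by rewrite ler_ln// posrE ?expR_gt0// mulr_gt0// expR_gt0.
rewrite expRK lnM ?posrE ?expR_gt0// expRK => hm; apply: le_trans hm _.
apply: lerD; last by rewrite /K le_eqVlt; apply/orP; left; apply/eqP; ring.
have GR : 0 < #|{: G}|%:R :> R by rewrite ltr0n.
rewrite !card_prod card_ord !natrM lnM ?posrE ?mulr_gt0// addrC lerD2l.
rewrite !lnM ?posrE ?mulr_gt0//.
by move: lnG; move: (ln _) (d.+1%:R * _) => x y xy; lra.
Qed.

End RayDiscrepancy.

(** * The error term *)

Section Rate.
Variables (R : realType) (d : nat).
Hypothesis d2 : (2 <= d)%N.

Definition rate (t : nat) : R :=
  t%:R `^ (1 / 2 - 1 / (2 * d%:R)) * Num.sqrt (ln (t%:R + 1)).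

(** The power t^(1 - 1/d). *)
Definition co_root (t : nat) : R := droot R d t ^+ d.-1.

Lemma ln2_ge_half : 1 / 2 <= ln 2 :> R.
Proof.
have := @le_ln1Dx R (- (1 / 2)) _.
have -> : 1 + - (1 / 2) = 2^-1 :> R by field.
by rewrite lnV ?posrE// lerN2; apply; lra.
Qed.

Lemma ln_succ_ge_half t : (0 < t)%N -> 1 / 2 <= ln (t%:R + 1) :> R.
Proof.
move=> t0; apply: le_trans ln2_ge_half _; by rewrite ler_ln ?posrE// natr1 ?ltr0n// ler_nat.
Qed.

Lemma droot_ge1 t : (0 < t)%N -> 1 <= droot R d t.
Proof.
move=> t0; have := droot_exp R d2 t => h; rewrite leNgt; apply/negP => lt1.
have : droot R d t ^+ d < 1.
  by rewrite exprn_ilt1 ?droot_ge0//; apply/eqP => d0; move: d2; rewrite d0.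
by rewrite h ltNge -[1]/(1%:R) ler_nat t0.
Qed.

Lemma co_root_mul t : droot R d t * co_root t = t%:R.
Proof. by rewrite /co_root -exprS prednK ?droot_exp//; apply: ltnW. Qed.

Lemma co_root_ge1 t : (0 < t)%N -> 1 <= co_root t.
Proof. by move=> t0; rewrite exprn_ege1// droot_ge1. Qed.

Lemma co_root_gt0 t : (0 < t)%N -> 0 < co_root t.
Proof. by move=> /co_root_ge1; apply: lt_le_trans. Qed.

Lemma le_co_root_sqr t : (0 < t)%N -> t%:R <= co_root t ^+ 2.
Proof.
move=> t0; rewrite -(droot_exp R d2 t) -exprM; apply: ler_weXn2l.
  exact: droot_ge1.
by move: d2; case: (d) => [|[|e]]// _; lia.
Qed.

Lemma ln_succ_le_co_root t : (0 < t)%N -> ln (t%:R + 1) <= 2 * co_root t.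
Proof.
move=> t0; have E0 := co_root_gt0 t0.
apply: (@le_trans _ _ (ln ((1 + co_root t) ^+ 2))).
  rewrite ler_ln ?posrE ?exprn_gt0 ?natr1 ?ltr0n ?addr_gt0// -natr1.
  have := le_co_root_sqr t0; rewrite sqrrD expr1n mul1r => h; lra.
rewrite lnXn ?addr_gt0// -[leLHS]mulr_natl ler_wpM2l//; apply: le_ln1Dx.
exact: lt_trans E0.
Qed.

Lemma rate_ge0 t : 0 <= rate t.
Proof. by rewrite mulr_ge0 ?powR_ge0// sqrtr_ge0. Qed.

Lemma rate_sqr t : (0 < t)%N -> rate t ^+ 2 = co_root t * ln (t%:R + 1).
Proof.
move=> t0; rewrite /rate exprMn sqr_sqrtr; last first.
  by apply: le_trans (ln_succ_ge_half t0).
have pow (x : R) n : (t%:R `^ x) ^+ n = t%:R `^ (x * n%:R) :> R.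
  by rewrite -[LHS]powR_mulrn ?powR_ge0// -powRrM.
have d0 : d%:R != 0 :> R by rewrite pnatr_eq0 -lt0n; apply: ltnW.
have -> : co_root t = t%:R `^ (d%:R^-1 * d.-1%:R) by exact: pow.
rewrite pow; congr (_ `^ _ * _).
have -> : d.-1%:R = d%:R - 1 :> R by rewrite -subn1 natrB//; apply: ltnW.
by field.
Qed.

Lemma rate_ge_half t : (0 < t)%N -> 1 / 2 <= rate t.
Proof.
move=> t0; have h : (1 / 2) ^+ 2 <= rate t ^+ 2.
  rewrite rate_sqr//; have := co_root_ge1 t0; have := ln_succ_ge_half t0.
  by move: (co_root t) (ln _) => x y hx hy; nra.
by rewrite -(@ler_pXn2r _ 2)// nnegrE ?rate_ge0// divr_ge0.
Qed.

Lemma rate_le t : (0 < t)%N -> rate t <= t%:R.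
Proof.
move=> t0; rewrite -(@ler_pXn2r _ 2)// ?nnegrE ?rate_ge0//.
rewrite rate_sqr// expr2; apply: ler_pM.
- by apply: ltW; apply: co_root_gt0.
- by apply: le_trans (ln_succ_ge_half t0).
- rewrite -[leRHS]co_root_mul; apply: ler_peMl; first by apply: ltW; apply: co_root_gt0.
  exact: droot_ge1.
- rewrite addrC; apply: le_ln1Dx; apply: (@lt_le_trans _ _ 0) => //.
Qed.

(** When the argument grows by a factor z^4 the rate grows by O(z^3) only, so the increment
of the argument eventually dominates every constant multiple of the rate. *)
Lemma rate_growth (z : R) t m : 1 <= z -> (0 < t)%N -> (t <= m)%N -> m%:R <= z ^+ 4 * t%:R ->
  rate m <= 3 * z ^+ 3 * rate t.
Proof.
move=> z1 t0 tm mz; have m0 : (0 < m)%N by apply: leq_trans tm.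
have z0 : 0 <= z by apply: le_trans z1.
rewrite -(@ler_pXn2r _ 2)// ?nnegrE ?rate_ge0// ?mulr_ge0 ?rate_ge0 ?exprn_ge0//.
rewrite [leRHS]exprMn !rate_sqr//.
have hE : co_root m <= z ^+ 4 * co_root t.
  have yt := lt_le_trans ltr01 (droot_ge1 t0).
  rewrite -(ler_pM2l yt) mulrCA co_root_mul; apply: le_trans mz.
  rewrite -[leRHS]co_root_mul; apply: ler_wpM2r; first by apply: ltW; apply: co_root_gt0.
  exact: ler_droot.
have lt := ln_succ_ge_half t0.
have hl : ln (m%:R + 1) <= 9 * z * ln (t%:R + 1).
  have z4 : 1 <= z ^+ 4 by rewrite exprn_ege1.
  have zp : 0 < z by apply: lt_le_trans z1.
  have z4p : 0 < z ^+ 4 by apply: lt_le_trans z4.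
  have sp (n : nat) : 0 < n%:R + 1 :> R by rewrite natr1 ltr0n.
  apply: (@le_trans _ _ (ln (z ^+ 4 * (t%:R + 1)))).
    rewrite ler_ln ?posrE ?mulr_gt0//.
    by rewrite mulrDr mulr1; apply: lerD.
  rewrite lnM ?posrE// lnXn// -[_ *+ 4]mulr_natl.
  have lnz : ln z <= z.
    have h : - 1 < z - 1 by lra.
    have := le_ln1Dx h; rewrite addrCA subrr addr0 => h2.
    by apply: le_trans h2 _; lra.
  have h1 : 0 <= z * (ln (t%:R + 1) - 1 / 2) by rewrite mulr_ge0// subr_ge0.
  have h2 : 0 <= (z - 1) * ln (t%:R + 1).
    by rewrite mulr_ge0// ?subr_ge0//; apply: le_trans lt.
  by move: (ln z) (ln _) lnz h1 h2 => x l; lra.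
apply: (@le_trans _ _ ((z ^+ 4 * co_root t) * (9 * z * ln (t%:R + 1)))).
  apply: ler_pM => //; first by apply: ltW; apply: co_root_gt0.
  by apply: le_trans (ln_succ_ge_half m0).
have -> : (3 * z ^+ 3) ^+ 2 * (co_root t * ln (t%:R + 1)) =
   z * (z ^+ 4 * co_root t * (9 * z * ln (t%:R + 1))) by ring.
have Et := ltW (co_root_gt0 t0).
have lt0 : 0 <= ln (t%:R + 1) :> R by apply: le_trans lt.
have z40 : 0 <= z ^+ 4 by rewrite exprn_ge0.
by apply: ler_peMl => //; apply: mulr_ge0; apply: mulr_ge0 => //; apply: mulr_ge0.
Qed.

End Rate.

Section DiscrepancyRate.
Import mathcomp.boot.fintype mathcomp.boot.finset.
Variables (R : realType) (d r : nat).
Hypothesis d2 : (2 <= d)%N.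

(** The two error terms of [ray_discrepancy] are log(m + 1) / theta and theta m^(1 - 1/d) up
to constants, and [theta] is chosen to balance them. *)
Lemma ray_discrepancy_rate : exists D : R, 0 <= D /\
  forall (m : nat) (I : finType) (a : I -> 'rV[R]_d) (b : I -> R),
  (0 < m)%N -> #|I| = (r.+1 * m)%N -> (forall i, a i != 0%R) ->
  exists c : I -> 'I_r.+1, forall p v j,
    (#|met_by_ray a b p v|%:R - r.+1%:R * #|[set i in met_by_ray a b p v | c i == j]|%:R)%R
      <= D * rate R d m.
Proof.
pose rho : R := r.+1%:R; have rho1 : 1 <= rho by rewrite /rho -[1]/(1%:R) ler_nat.
pose g := grouping_const R d r.+1.
have g0 : 0 <= g by apply: le_trans (grouping_const_ge8 R d r.+1).
pose A1 := 2 * rho + 4 * (d.+1%:R * (2 * rho + 1)).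
pose A2 := 2 * (2 * (d.+1%:R * (2 * rho + 1)) + 2 * g).
have dd : 0 <= d.+1%:R :> R by [].
have rho_gt0 : 0 < rho by apply: lt_le_trans rho1.
have rho0 : 0 <= rho by apply: ltW.
have s0 : 0 <= 2 * rho + 1 by apply: addr_ge0 => //; apply: mulr_ge0.
have ds0 : 0 <= d.+1%:R * (2 * rho + 1) by apply: mulr_ge0.
have A10 : 0 <= A1 by apply: addr_ge0; apply: mulr_ge0.
have A20 : 0 <= A2.
  by apply: mulr_ge0 => //; apply: addr_ge0; apply: mulr_ge0.
exists (4 * rho * A1 + 2 * rho * A2); split.
  by apply: addr_ge0; apply: mulr_ge0 => //; apply: mulr_ge0.
move=> m I a b m0 cI a0.
pose E := co_root R d m; pose l : R := ln (m%:R + 1); pose q := rate R d m.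
have E0 : 0 < E by apply: co_root_gt0.
have lE : l <= 2 * E by apply: ln_succ_le_co_root.
have l2 : 1 / 2 <= l by apply: ln_succ_ge_half.
have q2 : q * q = E * l by rewrite -expr2; apply: rate_sqr.
have q0 : 0 < q by apply: lt_le_trans (rate_ge_half R d2 m0); rewrite divr_gt0.
have qE : q <= 2 * E.
  rewrite leNgt; apply/negP => h.
  by have : 2 * E * (2 * E) < q * q; [apply: ltr_pM; rewrite ?mulr_ge0// ltW|nra].
pose theta := q / (4 * rho * E).
have th0 : 0 < theta by rewrite divr_gt0// !mulr_gt0.
have thr : theta * r.+1%:R = q / (4 * E).
  by rewrite /theta -/rho; field; rewrite !gt_eqF.
have thr2 : theta * r.+1%:R <= 1 / 2.
  by rewrite thr ler_pdivrMr ?mulr_gt0// (_ : 1 / 2 * (4 * E) = 2 * E)//; field.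
have [c cP] := ray_discrepancy b a0 d2 cI th0 thr2.
exists c => p v j; have := cP p v j.
set exc := (_ - _)%R; move: exc => exc.
have mp : 0 < m%:R + 1 :> R by rewrite natr1 ltr0n.
have rl : 0 <= rho * (l - 1 / 2) by rewrite mulr_ge0// subr_ge0.
have lrho : ln rho <= 2 * rho * l.
  have h : - 1 < rho - 1 by rewrite ltrBrDr addrC subrr.
  have := le_ln1Dx h; rewrite addrCA subrr addr0 => h2.
  by apply: le_trans h2 _; move: rl; lra.
have lnN : ln (#|I|.+1%:R) <= (2 * rho + 1) * l.
  apply: (@le_trans _ _ (ln (rho * (m%:R + 1)))).
    rewrite ler_ln ?posrE ?mulr_gt0//.
    have IN : (#|I|.+1 <= r.+1 * m.+1)%N by rewrite cI mulnS addSn ltnS leq_addl.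
    have -> : rho * (m%:R + 1) = (r.+1 * m.+1)%:R by rewrite natrM -[m.+1%:R]natr1.
    by rewrite ler_nat.
  by rewrite lnM ?posrE// -/l mulrDl mul1r lerD2r.
have kap : crossing_bound R I d r m <= A2 * E.
  rewrite /crossing_bound -/g -/(co_root R d m) -/E.
  have h2 := ln2_ge_half R.
  rewrite ler_pdivrMr; last by apply: lt_le_trans h2; rewrite divr_gt0.
  have h3 : d.+1%:R * ln #|I|.+1%:R <= d.+1%:R * (2 * rho + 1) * (2 * E).
    apply: le_trans (ler_wpM2l dd lnN) _; rewrite [leLHS]mulrA.
    by apply: ler_wpM2l.
  apply: (@le_trans _ _ (A2 * E * (1 / 2))); last first.
    by apply: ler_wpM2l => //; apply: mulr_ge0 => //; apply: ltW.
  have -> : A2 * E * (1 / 2) = d.+1%:R * (2 * rho + 1) * (2 * E) + 2 * g * E.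
    by rewrite /A2; field.
  exact: lerD.
have hb : ln r.+1%:R + 4 * (d.+1%:R * ln #|I|.+1%:R) <= A1 * l.
  rewrite /A1 [leRHS]mulrDl; apply: lerD => //.
  rewrite -[leRHS]mulrA; apply: ler_wpM2l => //.
  by rewrite -[leRHS]mulrA; apply: ler_wpM2l.
move=> h; have {h} h : theta * exc <= A1 * l + 8 * (theta * r.+1%:R) ^+ 2 * (A2 * E).
  apply: le_trans h _; apply: lerD => //; apply: ler_wpM2l => //.
  by rewrite mulr_ge0// sqr_ge0.
rewrite -(ler_pM2l th0); apply: le_trans h _; rewrite thr le_eqVlt; apply/orP; left; apply/eqP.
have rhon : rho != 0 by rewrite gt_eqF.
have En : E != 0 by rewrite gt_eqF.
have -> : l = q * q / E by rewrite q2 mulrC mulKf.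
rewrite -/q /theta; field.
by rewrite En addrC natr1 pnatr_eq0.
Qed.

End DiscrepancyRate.

Local Open Scope classical_set_scope.

(** * Tolerant partitions *)

Section HullCertificate.
Variables (R : realType) (d : nat).
Implicit Types p v : 'rV[R]_d.

Lemma ray_meets_hyperplane (a : 'rV[R]_d) (b : R) p v : a != 0 ->
  (dot a p - b) * dot a v <= 0 ->
  let H := [set x : 'rV[R]_d | \sum_(i < d) a 0 i * x 0 i = b] in
  closed_ray p v `&` H !=set0 \/ direction H v.
Proof.
move=> a0 le0 H; have [av|av] := eqVneq (dot a v) 0.
  right; have aa : dot a a != 0 by rewrite dot_eq0.
  exists ((b / dot a a) *: a), ((b / dot a a) *: a + v).
  have H1 : dot a ((b / dot a a) *: a) = b by rewrite dotZr divfK.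
  split; [exact: H1| |by rewrite addrC addKr].
  by rewrite /H /= -/(dot a _) dotDr av addr0.
left; exists (p + ((b - dot a p) / dot a v) *: v); split; last first.
  by rewrite /H /= -/(dot a _) dotDr dotZr divfK// addrC subrK.
exists ((b - dot a p) / dot a v); split=> //.
have -> : (b - dot a p) / dot a v = (dot a v)^-1 ^+ 2 * - ((dot a p - b) * dot a v) by field.
by rewrite mulr_ge0 ?sqr_ge0// oppr_ge0.
Qed.

Lemma regression_hull0 p : (0 < d)%N -> ~ regression_hull set0 p.
Proof.
move=> d0 h; have [|H []//] := h (const_mx 1).
apply/eqP => /rowP/(_ (Ordinal d0)); rewrite !mxE => /eqP.
by rewrite oner_eq0.
Qed.

End HullCertificate.

Section Bounds.
Variables (R : realType) (d r : nat).
Hypothesis d2 : (2 <= d)%N.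

Local Open Scope card_scope.

Lemma card_le_indices (T : Type) (I : finType) (f : I -> T) (C : set T) (t : nat) :
  injective f -> C #<= `I_t -> (#|[set i | `[<C (f i)>]]%SET| <= t)%N.
Proof.
move=> finj /pcard_leP/unsquash g.
set D := [set i | `[<C (f i)>]]%SET.
have DC i : i \in enum D -> C (f i).
  by rewrite mem_enum => h; apply/asboolP; move: h; rewrite inE.
have gI : {in enum D &, injective (fun i => g (f i))}.
  by move=> i j /DC Ci /DC Cj gij; apply: finj; apply: (inj (f := g)) gij; apply/mem_set.
rewrite cardE -(size_map (fun i => g (f i))) -[leqRHS](size_iota 0).
apply: uniq_leq_size; first by rewrite map_inj_in_uniq ?enum_uniq.
move=> _ /mapP[i /DC Ci ->].
rewrite mem_iota /= add0n.
exact: (@funS _ _ _ _ g _ Ci).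
Qed.

(** Suppose that [common_hull_or_escape] yields rays instead of a common point. They cover the
family, while the ray of label [j] meets part [j] only in deleted hyperplanes, so the
discrepancy bound forces the number of deleted hyperplanes above [t]. *)
Lemma tolerant_of_discrepancy : exists D : R, 0 <= D /\
  forall t m : nat, (0 < m)%N -> t%:R + D * rate R d m < m%:R ->
    tolerant_partition_size R t d r.+1 (r.+1 * m).
Proof.
have [D [D0 DP]] := @ray_discrepancy_rate R d r d2; exists D; split=> //.
move=> t m m0 tm X Xh XN.
have [f fb] : exists f : nat -> set 'rV[R]_d, set_bij `I_(r.+1 * m) X f.
  by apply/card_set_bijP; rewrite card_eq_sym.
pose I := 'I_(r.+1 * m); pose F (i : I) := f i.
have FX (i : I) : X (F i) by apply: (set_bij_sub fb); exists (i : nat) => //=.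
have Finj : injective F.
  move=> i j ij; apply/val_inj; apply: (set_bij_inj fb) => //; by rewrite inE /=.
have Fsurj H : X H -> exists i, F i = H.
  move=> XH; have [n /= nN <-] := set_bij_surj fb XH.
  by exists (Ordinal nN).
have /choice[ab abP] : forall i : I, exists ab : 'rV[R]_d * R, ab.1 != 0 /\
    F i = [set x | \sum_(j < d) ab.1 0 j * x 0 j = ab.2].
  by move=> i; have [a [b [a0 e]]] := Xh _ (FX i); exists (a, b).
pose a i := (ab i).1; pose b i := (ab i).2.
have [c cP] := DP m I a b m0 (card_ord _) (fun i => (abP i).1).
exists (fun j => [set H | exists2 i, c i = j & F i = H]); split.
- apply/seteqP; split=> [H [j _ [i _ <-]]//|H /Fsurj[i <-]].
  by exists (c i) => //; exists i.
- by apply/trivIsetP => j k _ _ jk; apply/seteqP; split=> // H [[i ci <-] [l cl /Finj lE]];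
    move: jk; rewrite -ci -cl lE eqxx.
move=> C CX Ct.
pose Y j := [set i | (c i == j) && ~~ `[<C (F i)>]]%SET.
case: (common_hull_or_escape a b Y) => [[p pP]|[p [J [v [vY vcov]]]]].
  exists p => j _ w w0; have [i] := pP j w.
  rewrite inE => /andP[/eqP ci /asboolP nC] le0.
  exists (F i); split; first by split=> //; exists i.
  by rewrite (abP i).2; apply: ray_meets_hyperplane => //; exact: (abP i).1.
exfalso; move: tm; apply/negP; rewrite -leNgt.
pose S j := met_by_ray a b p (v j).
have cover : (r.+1 * m <= \sum_(j in J) #|S j|)%N.
  rewrite -[X in (X <= _)%N](card_ord (r.+1 * m)) -sum1_card.
  apply: (@leq_trans (\sum_(i : I) \sum_(j in J) (i \in S j))%N).
    apply: leq_sum => i _; have [j jJ le0] := vcov i.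
    by rewrite (bigD1 j)//= inE le0.
  rewrite exchange_big /=; apply: leq_sum => j _.
  by rewrite -sum1_card [leqRHS]big_mkcond /=; apply: leq_sum => i _; case: (_ \in _).
have killed : (\sum_(j in J) #|[set i in S j | c i == j]%SET| <= t)%N.
  apply: leq_trans (card_le_indices Finj Ct).
  rewrite -sum1_card (partition_big c xpredT)//= [leqRHS](bigID (fun j => j \in J))/=.
  apply: leq_trans (leq_addr _ _); apply: leq_sum => j jJ; rewrite sum1_card.
  apply: subset_leq_card; apply/fintype.subsetP => i; rewrite inE => /andP[iS /eqP ci].
  rewrite unfold_in /= ci eqxx andbT inE; apply/asboolP; apply: contrapT => nC.
  have := vY j i jJ; rewrite inE ci eqxx /= => /(_ _); move: iS; rewrite inE leNgt => /negP h1 h2.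
  by apply: h1; apply: h2; apply/asboolP.
have rho0 : 0 < r.+1%:R :> R by rewrite ltr0n.
rewrite -(ler_pM2l rho0) -natrM.
apply: (@le_trans _ _ (\sum_(j in J) #|S j|)%:R); first by rewrite ler_nat.
rewrite natr_sum.
apply: (@le_trans _ _ (\sum_(j in J) (r.+1%:R * #|[set i in S j | c i == j]%SET|%:R + D * rate R d m))).
  by apply: ler_sum => j _; rewrite -lerBlDl; exact: cP.
rewrite big_split /= -mulr_sumr -natr_sum mulrDr; apply: lerD.
  by rewrite ler_pM2l// ler_nat.
rewrite sumr_const -[leLHS]mulr_natl; apply: ler_wpM2r.
  by rewrite mulr_ge0// rate_ge0.
by rewrite ler_nat; apply: leq_trans (max_card _) _; rewrite card_ord.
Qed.

(** Parallel hyperplanes provide a family of any size. Some part has at most [t] of them, and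
deleting it leaves the empty family, whose hull is empty. *)
Lemma tolerant_size_ge t M : (0 < M)%N ->
  tolerant_partition_size R t d r.+1 M -> (r.+1 * t <= M)%N.
Proof.
move=> M0 tol; rewrite leqNgt; apply/negP => Mt.
have d0 : (0 < d)%N by apply: ltnW.
pose i0 := Ordinal d0.
pose f : nat -> set 'rV[R]_d := fun n =>
  [set x : 'rV[R]_d | \sum_(i < d) (delta_mx 0 i0 : 'rV[R]_d) 0 i * x 0 i = n%:R].
have dE (x : 'rV[R]_d) : \sum_(i < d) (delta_mx 0 i0 : 'rV[R]_d) 0 i * x 0 i = x 0 i0.
  rewrite (bigD1 i0)//= mxE !eqxx mul1r big1 ?addr0// => i ii0.
  by rewrite mxE eqxx (negbTE ii0) mul0r.
have finj : injective f.
  move=> n k nk; have : f n (n%:R *: delta_mx 0 i0).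
    by rewrite /f /= dE !mxE !eqxx mulr1.
  by rewrite nk /f /= dE !mxE !eqxx mulr1 => /eqP; rewrite eqr_nat => /eqP.
have Xh : f @` `I_M `<=` hyperplane.
  move=> _ [n _ <-]; exists (delta_mx 0 i0), n%:R; split=> //.
  by apply/eqP => /rowP/(_ i0); rewrite !mxE !eqxx => /eqP; rewrite oner_eq0.
have XM : f @` `I_M #= `I_M by apply: inj_card_eq => x y _ _; exact: finj.
have [P [PX Pdis Ptol]] := tol _ Xh XM.
pose D j := [set i : 'I_M | `[<P j (f i)>]]%SET.
have [j jt] : exists j, (#|D j| <= t)%N.
  apply: contrapT => /forallNP h; move: Mt; apply/negP; rewrite -leqNgt.
  have le1 : (\sum_(j < r.+1) #|D j| <= M)%N.
    rewrite -[leqRHS]card_ord -sum1_card.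
    apply: (@leq_trans (\sum_(i < M) \sum_(j < r.+1) (i \in D j))%N).
      rewrite exchange_big /= leq_sum// => j _.
      by rewrite -sum1_card big_mkcond /= leq_sum// => i _; case: (_ \in _).
    apply: leq_sum => i _.
    have [[j ij]|noj] := pselect (exists j, i \in D j); last first.
      by rewrite big1// => j _; case: (boolP (i \in D j)) => // ij; case: noj; exists j.
    rewrite (bigD1 j)//= ij big1// => k kj; case: (boolP (i \in D k)) => // ik.
    move: ij; rewrite inE => /asboolP ij; move: ik; rewrite inE => /asboolP ik.
    have /trivIsetP/(_ k j Logic.I Logic.I kj)/seteqP[/(_ (f i)) h0 _] := Pdis.
    by case: h0.
  apply: leq_trans le1; rewrite -[r.+1 in leqLHS]card_ord -sum_nat_const.
  by apply: leq_sum => j _; have /negP := h j; rewrite -ltnNge => /ltnW.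
pose s := [seq nat_of_ord i | i <- enum (D j)].
have PjE : P j `<=` (f \o nth 0%N s) @` `I_(size s).
  move=> H PjH; have : (f @` `I_M) H by rewrite -PX; exists j.
  move=> [n /= nM nH]; exists (index n s) => /=; last first.
    rewrite nth_index//; apply/mapP; exists (Ordinal nM) => //.
    by rewrite mem_enum inE; apply/asboolP; rewrite /= nH.
  rewrite index_mem; apply/mapP; exists (Ordinal nM) => //.
  by rewrite mem_enum inE; apply/asboolP; rewrite /= nH.
have Pjt : P j #<= `I_t.
  apply: card_le_trans (subset_card_le PjE) _.
  apply: card_le_trans (card_image_le _ _) _; apply: subset_card_le => n /= ns.
  by apply: leq_trans ns _; rewrite size_map -cardE.
have PjX : P j `<=` f @` `I_M by rewrite -PX => H; exists j.
have [p /(_ j Logic.I)] := Ptol (P j) PjX Pjt.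
by rewrite setDv; exact: regression_hull0.
Qed.

End Bounds.

Theorem theorem2 (R : realType) (d r : nat) (hd : (2 <= d)%N) (hr : (2 <= r)%N) :
  exists C : R, 0 < C /\
    forall t : nat, (0 < t)%N ->
      exists N : nat, is_Nhyp R t d r N /\
        `|N%:R - r%:R * t%:R|
          <= C * t%:R `^ (1 / 2 - 1 / (2 * d%:R)) * Num.sqrt (ln (t%:R + 1)).
Proof.
case: r hr => // r hr.
have [D [D0 DP]] := @tolerant_of_discrepancy R d r hd.
(* With m <= z^4 t the rate grows by at most 3 z^3, and D times this is absorbed by
   K = z^4 - 2 as soon as z - 2 >= 3 D. *)
pose z : R := 3 * D + 2; pose K := z ^+ 4 - 2.
have z2 : 2 <= z by rewrite /z lerDr mulr_ge0.
have z1 : 1 <= z by apply: le_trans z2; rewrite ler1n.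
have z0 : 0 <= z by apply: le_trans z1.
have zK : 3 * D * z ^+ 3 <= K.
  have z3 : 1 <= z ^+ 3 by rewrite exprn_ege1.
  have -> : 3 * D = z - 2 by rewrite /z addrK.
  rewrite /K exprS; lra.
have K0 : 0 <= K by apply: le_trans zK; rewrite !mulr_ge0 ?exprn_ge0.
exists (r.+1%:R * z ^+ 4); split.
  by rewrite mulr_gt0 ?ltr0n// exprn_gt0//; apply: lt_le_trans z1.
move=> t t0; rewrite -mulrA -/(rate R d t).
pose q := rate R d t.
have q_half : 1 / 2 <= q by apply: rate_ge_half.
have qt : q <= t%:R by apply: rate_le.
have q0 : 0 <= q by apply: rate_ge0.
have t1 : 1 <= t%:R :> R by rewrite -[1]/(1%:R) ler_nat.
pose u := (Num.truncn (K * q)).+1; pose m := (t + u)%N.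
have u_gt : K * q < u%:R by apply: truncnS_gt.
have u_le : u%:R <= K * q + 1.
  by rewrite /u -natr1 lerD2r truncn_le mulr_ge0.
have m0 : (0 < m)%N by rewrite addn_gt0 t0.
have tol : tolerant_partition_size R t d r.+1 (r.+1 * m).
  apply: DP => //; rewrite natrD ltrD2l; apply: le_lt_trans u_gt.
  apply: (@le_trans _ _ (D * (3 * z ^+ 3 * q))).
    apply: ler_wpM2l => //; apply: rate_growth => //; first exact: leq_addr.
    have Kt : K * q <= K * t%:R by apply: ler_wpM2l.
    rewrite natrD; apply: (@le_trans _ _ (t%:R + (K * t%:R + t%:R))).
      by rewrite lerD2l; apply: le_trans u_le _; apply: lerD.
    by rewrite /K le_eqVlt; apply/orP; left; apply/eqP; ring.
  have -> : D * (3 * z ^+ 3 * q) = 3 * D * z ^+ 3 * q by ring.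
  exact: ler_wpM2r.
pose good M := `[<(0 < M)%N /\ tolerant_partition_size R t d r.+1 M>].
have exgood : exists M, good M.
  by exists (r.+1 * m)%N; apply/asboolP; rewrite muln_gt0.
have [N /asboolP[N0 Ntol] Nmin] := ex_minnP exgood.
exists N; split.
  by split=> // M M0 Mtol; apply: Nmin; apply/asboolP.
have lo : (r.+1 * t <= N)%N by apply: tolerant_size_ge Ntol.
have up : (N <= r.+1 * m)%N by apply: Nmin; apply/asboolP; rewrite muln_gt0.
rewrite -natrM -natrB// ger0_norm// -mulrA.
apply: (@le_trans _ _ (r.+1%:R * u%:R)).
  by rewrite -natrM ler_nat leq_subLR -mulnDr.
apply: ler_wpM2l => //; apply: le_trans u_le _.
have -> : z ^+ 4 * q = K * q + 2 * q by rewrite /K; ring.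
by rewrite lerD2l; lra.
Qed.
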